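(* Let $G$ be the graph of a local flat folding of the plane, and suppose that $G$ is finite. Then removing from $G$ any set of at most three of the vertex points of the folding (that is, at most three vertices of $G$ other than the special vertex $\infty$) cannot cause the remaining graph to become disconnected.
   Context: Local flat folding: a continuous function $\varphi:\mathbb{R}^2\to\mathbb{R}^2$ such that every point $p$ of the plane is of one of the following three types, and at least one point is a vertex point. (1) Unfolded point: $p$ has a neighborhood mapped by $\varphi$ in a distance-preserving way. (2) Crease point: $p$ has a neighborhood $N$ that can be covered by two subsets, each containing $p$ and each mapped by $\varphi$ in a different distance-preserving way. (Necessarily the boundary between the subsets is a line through $p$, and the two isometries are reflections of each other across the image of this line; points of $N$ on this line are also crease points and the other points of $N$ are unfolded points.) (3) Vertex point: $p$ has a neighborhood $N$ that can be covered by finitely many (at least three) subsets, each containing $p$ and each mapped by $\varphi$ in a distance-preserving way, with at least three distinct isometries among these subsets. (Necessarily each subset is a wedge with apex $p$; points of $N$ other than $p$ on the rays between pairs of wedges are crease points and the remaining points of $N$ other than $p$ are unfolded points.) Graph of a local flat folding $\varphi$: the multigraph $G$ with a vertex for each vertex point of $\varphi$ and, if $\varphi$ includes any infinite rays of crease points, one additional special vertex $\infty$. Two vertex points are joined by an edge when the line segment between them consists (apart from its endpoints) only of crease points. For each ray with apex at a vertex point $p$ all of whose points other than the apex are crease points, there is an edge between $p$ and $\infty$ (so there may be several parallel edges between $p$ and $\infty$, but at most one edge between any two vertex points). A graph is disconnected if it has two vertices with no path between them (so graphs with at most one vertex are not disconnected). *)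

(* Defs.v *)
From HB Require Import structures.
From mathcomp Require Import all_boot all_order all_algebra.
From mathcomp Require Import all_classical all_reals all_analysis.

Set Implicit Arguments.
Unset Strict Implicit.
Unset Printing Implicit Defensive.

Import Order.TTheory GRing.Theory Num.Theory.
Import numFieldNormedType.Exports.

Local Open Scope classical_set_scope.
Local Open Scope ring_scope.

Section Multigraph.
Variables V E : Type.

(* Vertices and edges are the elements of [vertices] and [edges];
   [joins e u v] is the (symmetric) relation "u and v are the ends of e". *)
Record multigraph := Multigraph {
  vertices : set V;
  edges : set E;
  joins : E -> V -> V -> Prop }.

Definition finite_multigraph (G : multigraph) : Prop :=
  finite_set (vertices G) /\ finite_set (edges G).

Definition remove_vertices (G : multigraph) (S : set V) : multigraph :=
  Multigraph (vertices G `\` S)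
    [set e | edges G e /\ forall u v, joins G e u v -> ~ S u /\ ~ S v]
    (joins G).

Definition adjacent_vertices (G : multigraph) (u v : V) : Prop :=
  exists2 e, edges G e & joins G e u v.

Definition connected_by_path (G : multigraph) (u v : V) : Prop :=
  exists2 p : seq V, path (fun x y => `[< adjacent_vertices G x y >]) u p & last u p = v.

Definition disconnected (G : multigraph) : Prop :=
  exists u v, [/\ vertices G u, vertices G v & ~ connected_by_path G u v].

End Multigraph.

Section FlatFolding.
Variable R : realType.

Local Notation plane := 'rV[R]_2.

(* The norm provided by the library on row vectors is the sup norm (it induces
   the same topology), so the Euclidean distance has to be defined. *)
Definition eucl_dist (x y : plane) : R :=
  Num.sqrt (\sum_(i < 2) (x ord0 i - y ord0 i) ^+ 2).

Definition distance_preserving_on (N : set plane) (f : plane -> plane) : Prop :=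
  forall x y, N x -> N y -> eucl_dist (f x) (f y) = eucl_dist x y.

Definition plane_isometry (f : plane -> plane) : Prop :=
  distance_preserving_on setT f.

(* N is a neighborhood of p covered by k subsets A i containing p, the i-th of
   which is mapped by phi in the distance-preserving way f i. *)
Definition isometric_cover (phi : plane -> plane) (p : plane) (N : set plane)
    (k : nat) (A : 'I_k -> set plane) (f : 'I_k -> plane -> plane) : Prop :=
  [/\ nbhs p N,
      N = \bigcup_i A i
    & forall i, [/\ A i p, plane_isometry (f i)
                  & forall x, A i x -> phi x = f i x]].

Definition unfolded_point (phi : plane -> plane) (p : plane) : Prop :=
  exists2 N : set plane, nbhs p N & distance_preserving_on N phi.

(* The three types of points are mutually exclusive.  This has to be imposed:
   the bare covering condition allows redundant pieces (such as the singleton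
   of p, on which phi agrees with many isometries), so that by itself it would
   make every unfolded point a crease point and every crease point a vertex
   point. *)
Definition crease_point (phi : plane -> plane) (p : plane) : Prop :=
  ~ unfolded_point phi p /\
  exists N (A : 'I_2 -> set plane) (f : 'I_2 -> plane -> plane),
    isometric_cover phi p N A f /\ f ord0 <> f ord_max.

Definition vertex_point (phi : plane -> plane) (p : plane) : Prop :=
  [/\ ~ unfolded_point phi p, ~ crease_point phi p
    & exists N k (A : 'I_k -> set plane) (f : 'I_k -> plane -> plane),
      [/\ (3 <= k)%N, isometric_cover phi p N A f
        & exists i j l, [/\ f i <> f j, f j <> f l & f i <> f l]]].

Definition local_flat_folding (phi : plane -> plane) : Prop :=
  [/\ continuous phi,
      forall p, [\/ unfolded_point phi p, crease_point phi p
                  | vertex_point phi p]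
    & exists p, vertex_point phi p].

Definition open_segment (p q : plane) : set plane :=
  [set (1 - t) *: p + t *: q | t in [set t : R | 0 < t < 1]].

Definition open_ray (p d : plane) : set plane :=
  [set p + t *: d | t in [set t : R | 0 < t]].

(* [Some p] is the vertex at the vertex point p, and [None] is the special
   vertex at infinity. *)
Definition folding_vertex (phi : plane -> plane) (u : option plane) : Prop :=
  match u with
  | Some p => vertex_point phi p
  | None => exists p d, d != 0 /\ open_ray p d `<=` crease_point phi
  end.

Definition segment_edge (phi : plane -> plane) (e : set plane) (p q : plane) :
    Prop :=
  [/\ vertex_point phi p, vertex_point phi q, p <> q, e = open_segment p q
    & e `<=` crease_point phi].

Definition ray_edge (phi : plane -> plane) (e : set plane) (p : plane) : Prop :=
  vertex_point phi p /\
  exists d, [/\ d != 0, e = open_ray p d & e `<=` crease_point phi].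

Definition folding_joins (phi : plane -> plane) (e : set plane)
    (u v : option plane) : Prop :=
  match u, v with
  | Some p, Some q => segment_edge phi e p q
  | Some p, None | None, Some p => ray_edge phi e p
  | None, None => False
  end.

(* An edge is represented by the set of points of the open segment or open ray
   that it stands for; an open ray determines its apex and an open segment its
   endpoints, so parallel edges to infinity are kept apart and distinct edges
   are never identified. *)
Definition folding_graph (phi : plane -> plane) :
    multigraph (option plane) (set plane) :=
  Multigraph (folding_vertex phi)
    [set e | exists u v, folding_joins phi e u v] (folding_joins phi).

End FlatFolding.

(* Main.v *)
(* Let E f be the set of points where phi agrees with an isometry f of the plane.
   Since phi is 1-Lipschitz and a degenerate triangle determines the point on its
   long side, E f is convex; this replaces the planar topology of faces. Near a
   vertex point no open half plane is free of creases.

   If G - S is disconnected, some finite set C of vertex points sends no crease to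
   infinity and only leads outside C to points of S. Maximising linear functionals
   over C shows that S consists of three corners a, b, c of a proper triangle whose
   interior contains C. Following creases inside a contact set shows that some E f
   contains both a and b, and likewise for the other two sides; so phi preserves the
   side lengths, and hence agrees with one isometry on the whole triangle. Then the
   points of C are unfolded, a contradiction. *)

Require Import Defs.
From mathcomp Require Import all_boot all_order all_algebra.
From mathcomp Require Import all_classical all_reals all_analysis.
From mathcomp Require Import ring lra.

Set Implicit Arguments.
Unset Strict Implicit.
Unset Printing Implicit Defensive.

Import Order.TTheory GRing.Theory Num.Theory.
Import numFieldNormedType.Exports.

Local Open Scope classical_set_scope.
Local Open Scope ring_scope.

(** * Plane geometry *)

Section PlaneGeometry.
Variable R : realType.
Local Notation plane := 'rV[R]_2.
Implicit Types (a b c p q x y z u v w : plane) (s t : R).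

(** The number three enters through rigidity: the side lengths of a triangle fix its image up to an
    isometry, whereas a quadrilateral with given sides can flex. The obstacle is that a side of the
    triangle need not carry any crease, so nothing local shows that its length is kept; hence the
    search for one isometry that [phi] matches at both ends of the side. Distances are squared
    throughout, so that metric facts become polynomial identities; Stewart's identity and the
    parallelogram law turn Lipschitz bounds into equalities. *)

Definition px x : R := x ord0 ord0.
Definition py x : R := x ord0 ord_max.
Definition cross u v : R := px u * py v - py u * px v.
Definition dot u v : R := px u * px v + py u * py v.
Definition dsq x y : R := (px x - px y) ^+ 2 + (py x - py y) ^+ 2.

Lemma plane_eq x y : px x = px y -> py x = py y -> x = y.
Proof.
move=> ex ey; apply/rowP=> -[[|[|//]] i].
  by rewrite (_ : Ordinal i = ord0) //; apply: val_inj.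
by rewrite (_ : Ordinal i = ord_max) //; apply: val_inj.
Qed.

Lemma pxD u v : px (u + v) = px u + px v. Proof. exact: mxE. Qed.
Lemma pyD u v : py (u + v) = py u + py v. Proof. exact: mxE. Qed.
Lemma pxN u : px (- u) = - px u. Proof. exact: mxE. Qed.
Lemma pyN u : py (- u) = - py u. Proof. exact: mxE. Qed.
Lemma pxZ t u : px (t *: u) = t * px u. Proof. exact: mxE. Qed.
Lemma pyZ t u : py (t *: u) = t * py u. Proof. exact: mxE. Qed.
Lemma px0 : px 0 = 0. Proof. exact: mxE. Qed.
Lemma py0 : py 0 = 0. Proof. exact: mxE. Qed.
Definition coordE := (pxD, pyD, pxN, pyN, pxZ, pyZ, px0, py0).

Lemma dsq_ge0 x y : 0 <= dsq x y.
Proof. by rewrite addr_ge0 ?sqr_ge0. Qed.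

Lemma dsqxx x : dsq x x = 0.
Proof. by rewrite /dsq !subrr expr0n addr0. Qed.

Lemma dsqC x y : dsq x y = dsq y x.
Proof. by rewrite /dsq; ring. Qed.

Lemma dsq_eq0 x y : (dsq x y == 0) = (x == y).
Proof.
apply/eqP/eqP => [|->]; last exact: dsqxx.
move=> /eqP; rewrite paddr_eq0 ?sqr_ge0 // !sqrf_eq0 !subr_eq0.
by move=> /andP[/eqP ? /eqP ?]; apply: plane_eq.
Qed.

Lemma dsq_gt0 x y : x != y -> 0 < dsq x y.
Proof. by move=> xy; rewrite lt_def dsq_ge0 dsq_eq0 xy. Qed.

Lemma dsq_le0 x y : dsq x y <= 0 -> x = y.
Proof. by move=> h; apply/eqP; rewrite -dsq_eq0 eq_le h dsq_ge0. Qed.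

Lemma eucl_distE x y : eucl_dist x y = Num.sqrt (dsq x y).
Proof.
rewrite /eucl_dist big_ord_recl big_ord1 /dsq /px /py.
by rewrite (_ : lift ord0 ord0 = ord_max) //; apply: val_inj.
Qed.

Lemma dsq_along a v s t : dsq (a + s *: v) (a + t *: v) = (s - t) ^+ 2 * dsq v 0.
Proof. by rewrite /dsq !coordE; ring. Qed.

Lemma dsq_base a v t : dsq (a + t *: v) a = t ^+ 2 * dsq v 0.
Proof. by rewrite /dsq !coordE; ring. Qed.

Lemma stewart z a b t :
  dsq z (a + t *: (b - a)) =
    (1 - t) * dsq z a + t * dsq z b - t * (1 - t) * dsq a b.
Proof. by rewrite /dsq !coordE; ring. Qed.

(** The triangle inequality without square roots: lengths are multiples [s] and [t] of a unit whose
    square is [D]. A weighted sum of the two hypotheses exceeds the claim by a square. *)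
Lemma dsq_triangle (D s t : R) x y z : 0 <= s -> 0 <= t ->
  dsq x y <= s ^+ 2 * D -> dsq y z <= t ^+ 2 * D -> dsq x z <= (s + t) ^+ 2 * D.
Proof.
rewrite le0r => /predU1P[->|s0] t0.
  by rewrite expr0n mul0r add0r => /dsq_le0 ->.
move: t0; rewrite le0r => /predU1P[->|t0].
  by rewrite expr0n mul0r addr0 => + /dsq_le0 <-.
move=> hxy hyz; rewrite -(ler_pM2l (mulr_gt0 s0 t0)).
have -> : s * t * dsq x z = (s + t) * (t * dsq x y + s * dsq y z)
    - dsq (t *: x + s *: z) ((s + t) *: y).
  by rewrite /dsq !coordE; ring.
apply: (@le_trans _ _ ((s + t) * (t * dsq x y + s * dsq y z))).
  by rewrite gerBl dsq_ge0.
rewrite [leRHS](_ : _ = (s + t) * (t * (s ^+ 2 * D) + s * (t ^+ 2 * D))); last by ring.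
by rewrite ler_pM2l ?addr_gt0 // lerD // ler_pM2l.
Qed.

(* Strict convexity of the Euclidean norm. *)
Lemma between_rigid A B Z t (D : R) : 0 <= t <= 1 -> dsq A B = D ->
  dsq Z A <= t ^+ 2 * D -> dsq Z B <= (1 - t) ^+ 2 * D ->
  Z = A + t *: (B - A).
Proof.
move=> /andP[t0 t1] hD hA hB; apply: dsq_le0; rewrite stewart hD.
have : (1 - t) * dsq Z A <= (1 - t) * (t ^+ 2 * D) by rewrite ler_wpM2l // subr_ge0.
have : t * dsq Z B <= t * ((1 - t) ^+ 2 * D) by rewrite ler_wpM2l.
have : (1 - t) * (t ^+ 2 * D) + t * ((1 - t) ^+ 2 * D) = t * (1 - t) * D by ring.
set k1 := (1 - t) * dsq Z A; set k2 := t * dsq Z B.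
set k3 := (1 - t) * (t ^+ 2 * D); set k4 := t * ((1 - t) ^+ 2 * D).
set k5 := t * (1 - t) * D; move: k1 k2 k3 k4 k5 => *; lra.
Qed.

Lemma dot_dsq a b c : dot (b - a) (c - a) = (dsq b a + dsq c a - dsq b c) / 2.
Proof. by rewrite /dot /dsq !coordE; field. Qed.

Lemma gram u v : cross u v ^+ 2 = dsq u 0 * dsq v 0 - dot u v ^+ 2.
Proof. by rewrite /cross /dot /dsq !coordE; ring. Qed.

Lemma dsq_sub x y : dsq x y = dsq (x - y) 0.
Proof. by rewrite /dsq !coordE !subr0. Qed.

(** Heron's formula: [cross] is twice the signed area, so the side lengths determine it up to
    sign. *)
Lemma cross_sq a b c : cross (b - a) (c - a) ^+ 2 =
  dsq b a * dsq c a - ((dsq b a + dsq c a - dsq b c) / 2) ^+ 2.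
Proof. by rewrite gram dot_dsq -!dsq_sub. Qed.

Lemma frame_expand e v : dsq e 0 *: v =
  dot e v *: e + cross e v *: (\row_i if i == ord0 then - py e else px e).
Proof.
apply: plane_eq; rewrite !coordE /dsq /dot /cross !coordE /px /py !mxE /=; ring.
Qed.

Lemma frame_inj e v w : e != 0 -> dot e v = dot e w -> cross e v = cross e w -> v = w.
Proof.
move=> e0 hd hc; have := frame_expand e v; rewrite hd hc -frame_expand.
by apply: scalerI; rewrite dsq_eq0.
Qed.

Lemma cross_sq_pm (k l : R) : k ^+ 2 = l ^+ 2 -> k = l \/ k = - l.
Proof. by move=> /eqP; rewrite eqf_sqr => /orP[] /eqP; [left|right]. Qed.

Lemma two_circles a b y z : dsq y a = dsq z a -> dsq y b = dsq z b ->
  cross (b - a) (y - a) = cross (b - a) (z - a) \/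
  cross (b - a) (y - a) = - cross (b - a) (z - a).
Proof. by move=> ha hb; apply: cross_sq_pm; rewrite !cross_sq ha (dsqC b y) hb (dsqC b z). Qed.

Lemma two_circles_eq a b y z : a != b -> dsq y a = dsq z a -> dsq y b = dsq z b ->
  cross (b - a) (y - a) = cross (b - a) (z - a) -> y = z.
Proof.
move=> ab ha hb hc; apply: (addIr (- a)); apply: frame_inj hc.
  by rewrite subr_eq0 eq_sym.
by rewrite !dot_dsq ha (dsqC b y) hb (dsqC b z).
Qed.

(** The three cross products agree up to sign, so two of them are equal and their points coincide:
    circles with distinct centres share at most two points. *)
Lemma two_circles3 a b x y z : a != b ->
  dsq x a = dsq y a -> dsq x b = dsq y b ->
  dsq x a = dsq z a -> dsq x b = dsq z b -> [\/ x = y, x = z | y = z].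
Proof.
move=> ab xya xyb xza xzb.
case: (two_circles xya xyb) => [?|hy]; first by constructor 1; apply: (two_circles_eq ab).
case: (two_circles xza xzb) => [?|hz]; first by constructor 2; apply: (two_circles_eq ab).
constructor 3; apply: (two_circles_eq ab) => //; first by rewrite -xya.
  by rewrite -xyb.
by apply: oppr_inj; rewrite -hy -hz.
Qed.

(** Equal distances make [x - y] orthogonal to both [b - a] and [c - a]; Cramer's rule then kills
    its coordinates. *)
Lemma trilateration a b c x y : cross (b - a) (c - a) != 0 ->
  dsq x a = dsq y a -> dsq x b = dsq y b -> dsq x c = dsq y c -> x = y.
Proof.
move=> abc ha hb hc.
have ba : a != b by apply: contraNneq abc => ->; rewrite subrr /cross !coordE !mul0r subrr.
have hd u : dot u (x - a) = dot u (y - a) -> dot u (x - y) = 0.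
  by rewrite /dot !coordE => h; rewrite -[RHS](subrr (px u * (px y - px a) + py u * (py y - py a))) -{1}h; ring.
have hB : dot (b - a) (x - y) = 0 by apply: hd; rewrite !dot_dsq ha (dsqC b x) hb (dsqC b y).
have hC : dot (c - a) (x - y) = 0 by apply: hd; rewrite !dot_dsq ha (dsqC c x) hc (dsqC c y).
have ex : cross (b - a) (c - a) * (px x - px y) =
   dot (b - a) (x - y) * py (c - a) - dot (c - a) (x - y) * py (b - a).
  by rewrite /cross /dot !coordE; ring.
have ey : cross (b - a) (c - a) * (py x - py y) =
   dot (c - a) (x - y) * px (b - a) - dot (b - a) (x - y) * px (c - a).
  by rewrite /cross /dot !coordE; ring.
by move: ex ey; rewrite hB hC !mul0r subrr => /eqP + /eqP;
  rewrite !mulf_eq0 (negPf abc) /= !subr_eq0 => /eqP ? /eqP ?; apply: plane_eq.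
Qed.

End PlaneGeometry.

(** * Isometries of the plane and reflections *)

Section Isometries.
Variable R : realType.
Local Notation plane := 'rV[R]_2.
Implicit Types (a b c p q x y z u v w : plane) (s t : R) (f g : plane -> plane).

Lemma plane_isometryP f :
  plane_isometry f <-> forall x y, dsq (f x) (f y) = dsq x y.
Proof.
split=> [iso x y|iso x y _ _]; last by rewrite !eucl_distE iso.
have := iso x y I I; rewrite !eucl_distE => /eqP.
by rewrite eqr_sqrt ?dsq_ge0 // => /eqP.
Qed.

Section OneIsometry.
Variables (f : plane -> plane) (iso : plane_isometry f).

Lemma iso_dsq x y : dsq (f x) (f y) = dsq x y.
Proof. exact: (plane_isometryP f).1. Qed.

Lemma iso_inj : injective f.
Proof. by move=> x y e; apply: dsq_le0; rewrite -iso_dsq e dsqxx. Qed.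

Lemma iso_affine a b t : f (a + t *: (b - a)) = f a + t *: (f b - f a).
Proof.
apply: dsq_le0; rewrite stewart !iso_dsq.
by rewrite [leLHS](_ : _ = 0) // /dsq !coordE; ring.
Qed.

Lemma iso_ray a v t : f (a + t *: v) = f a + t *: (f (a + v) - f a).
Proof. by have := iso_affine a (a + v) t; rewrite [a + v]addrC addrK. Qed.

Lemma iso_trilateration a b c x y : cross (b - a) (c - a) != 0 ->
  dsq y (f a) = dsq x a -> dsq y (f b) = dsq x b -> dsq y (f c) = dsq x c ->
  y = f x.
Proof.
move=> abc ha hb hc; apply: (@trilateration _ (f a) (f b) (f c)).
- by rewrite -sqrf_eq0 cross_sq !iso_dsq -cross_sq sqrf_eq0.
- by rewrite iso_dsq.
- by rewrite iso_dsq.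
- by rewrite iso_dsq.
Qed.

End OneIsometry.

Definition perp v : plane := \row_i if i == ord0 then - py v else px v.

Lemma px_perp v : px (perp v) = - py v. Proof. by rewrite /px mxE. Qed.
Lemma py_perp v : py (perp v) = px v. Proof. by rewrite {1}/py mxE. Qed.

Definition refl p x y : plane :=
  y - (2 * cross (x - p) (y - p) / dsq x p) *: perp (x - p).

(** The correction term shows that reflecting [y] in the line [px] moves it away from [z] exactly
    when both lie on the same side. *)
Lemma dsq_refl p x y z : p != x -> dsq (refl p x y) z =
  dsq y z + 4 * cross (x - p) (y - p) * cross (x - p) (z - p) / dsq x p.
Proof.
move=> px_neq; have : dsq x p != 0 by rewrite dsq_eq0 eq_sym.
rewrite /refl /cross /dsq !(px_perp, py_perp, coordE) => ?; field.
by [].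
Qed.

Lemma refl_id p x y : cross (x - p) (y - p) = 0 -> refl p x y = y.
Proof. by move=> h; rewrite /refl h mulr0 mul0r scale0r subr0. Qed.

Lemma cross0r v : cross v 0 = 0.
Proof. by rewrite /cross !coordE; ring. Qed.

Lemma crossvv v : cross v v = 0.
Proof. by rewrite /cross; ring. Qed.

Lemma reflp p x : refl p x p = p.
Proof. by rewrite refl_id // subrr cross0r. Qed.

Lemma reflx p x : refl p x x = x.
Proof. by rewrite refl_id // crossvv. Qed.

Lemma refl_fix p x y : p != x -> refl p x y = y -> cross (x - p) (y - p) = 0.
Proof.
move=> pxn h; have := dsq_refl y y pxn; rewrite h dsqxx add0r => /esym/eqP.
by rewrite mulf_eq0 invr_eq0 dsq_eq0 [x == p]eq_sym (negPf pxn) orbF mulf_eq0 mulf_eq0 pnatr_eq0 /=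
   orbb => /eqP.
Qed.

Lemma refl_iso p x : p != x -> plane_isometry (refl p x).
Proof.
move=> pxn; apply/plane_isometryP => y z.
have : dsq x p != 0 by rewrite dsq_eq0 eq_sym.
rewrite /refl /cross /dsq !(px_perp, py_perp, coordE) => ?; field.
by [].
Qed.

Lemma iso_comp f g : plane_isometry f -> plane_isometry g -> plane_isometry (f \o g).
Proof. by move=> hf hg; apply/plane_isometryP => x y /=; rewrite !iso_dsq. Qed.

Lemma iso_extend p x P X : p != x -> dsq X P = dsq x p ->
  exists f, [/\ plane_isometry f, f p = P & f x = X].
Proof.
move=> pxn h; have d0 : dsq x p != 0 by rewrite dsq_eq0 eq_sym.
(* In complex notation this is P + (X - P)(y - p)/(x - p): [dot] and [cross] give the real and
   imaginary parts of the quotient, and [perp] is multiplication by i. *)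
exists (fun y => P + (dot (x - p) (y - p) / dsq x p) *: (X - P)
  + (cross (x - p) (y - p) / dsq x p) *: perp (X - P)); split.
- apply/plane_isometryP => y z.
  pose D := (dot (x - p) (y - p) - dot (x - p) (z - p)) / dsq x p.
  pose C := (cross (x - p) (y - p) - cross (x - p) (z - p)) / dsq x p.
  transitivity ((D ^+ 2 + C ^+ 2) * dsq X P).
    by rewrite /D /C /dsq !(px_perp, py_perp, coordE); ring.
  rewrite h /D /C; move: d0; rewrite /dot /cross /dsq !coordE => d0; field.
  by [].
- by rewrite subrr /dot cross0r !coordE !mulr0 addr0 !mul0r !scale0r !addr0.
- rewrite crossvv mul0r scale0r addr0 (_ : dot _ _ = dsq x p) ?divff //.
    by rewrite scale1r addrC subrK.
  by rewrite /dot /dsq !coordE.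
Qed.

(** The circles about [f p] and [f x] that contain [Y] meet in the images of [y] and of its mirror
    image; these coincide only when [y] is on the mirror, where the circles are tangent. *)
Lemma iso_two f p x y Y : plane_isometry f -> p != x ->
  dsq Y (f p) = dsq y p -> dsq Y (f x) = dsq y x ->
  Y = f y \/ Y = f (refl p x y).
Proof.
move=> iso pxn hp hx.
have fpx : f p != f x by apply: contraNneq pxn => /(iso_inj iso) ->.
have rp : dsq (refl p x y) p = dsq y p by rewrite -{2}(reflp p x) iso_dsq //; apply: refl_iso.
have rx : dsq (refl p x y) x = dsq y x by rewrite -{2}(reflx p x) iso_dsq //; apply: refl_iso.
case: (@two_circles3 _ (f p) (f x) Y (f y) (f (refl p x y))); rewrite ?iso_dsq ?rp ?rx //.
- by left.
- by right.
move=> /(iso_inj iso) /esym /(refl_fix pxn) h; left.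
apply: (two_circles_eq fpx); rewrite ?iso_dsq //.
have h0 : cross (f x - f p) (f y - f p) = 0.
  by apply/eqP; rewrite -sqrf_eq0 cross_sq !iso_dsq // -cross_sq h expr0n.
by case: (@two_circles _ (f p) (f x) Y (f y)); rewrite ?iso_dsq // h0 ?oppr0.
Qed.

Lemma iso_line f p x y Y : plane_isometry f -> p != x -> cross (x - p) (y - p) = 0 ->
  dsq Y (f p) = dsq y p -> dsq Y (f x) = dsq y x -> Y = f y.
Proof.
move=> iso pxn h hp hx; case: (iso_two iso pxn hp hx) => //.
by rewrite refl_id.
Qed.

End Isometries.

(** By completeness: the supremum of the initial segments on which [P] holds is reached by the
    closure hypothesis and passed by the step hypothesis, so it cannot exist. *)
Lemma real_induction (R : realType) (P : R -> Prop) :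
  P 0 ->
  (forall s, 0 < s -> (forall t, 0 <= t < s -> P t) -> P s) ->
  (forall s, 0 <= s -> (forall t, 0 <= t <= s -> P t) ->
     exists2 e, 0 < e & forall t, s < t < s + e -> P t) ->
  forall s, 0 <= s -> P s.
Proof.
move=> P0 Pclose Pstep s s0; apply: contrapT => nPs.
pose A := [set r : R | 0 <= r /\ forall t, 0 <= t <= r -> P t].
have A0 : A 0.
  by split=> // t /andP[t0 t1]; have -> : t = 0 by apply/eqP; rewrite eq_le t0 t1.
have Aub : ubound A s.
  move=> r [r0 hr]; rewrite leNgt; apply/negP => sr; apply: nPs; apply: hr.
  by rewrite s0 ltW.
have hA : has_sup A by split; [exists 0|exists s].
have m0 : 0 <= sup A by apply: ub_le_sup => //; exists s.
have below t : 0 <= t < sup A -> P t.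
  move=> /andP[t0 tA].
  move: tA; rewrite -subr_gt0 => /sup_adherent /(_ hA) [r [_ hr]].
  by rewrite opprB addrC subrK => tr; apply: hr; rewrite t0 ltW.
have Psup : P (sup A).
  move: m0; rewrite le_eqVlt => /predU1P[<-//|m0]; exact: Pclose.
have Asup t : 0 <= t <= sup A -> P t.
  move=> /andP[t0]; rewrite le_eqVlt => /predU1P[->//|tA]; apply: below.
  by rewrite t0.
have [e e0 he] := Pstep _ m0 Asup.
have : A (sup A + e / 2).
  split=> [|t /andP[t0 te]]; first by rewrite addr_ge0 // divr_ge0 // ltW.
  case: (leP t (sup A)) => ht; first by apply: Asup; rewrite t0.
  by apply: he; rewrite ht /=; apply: le_lt_trans te _; lra.
move=> /(ub_le_sup (ex_intro _ s Aub)); rewrite gerDl leNgt => /negP; apply.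
by rewrite divr_gt0.
Qed.

(** * Sheets and contact sets *)

Section Neighbourhoods.
Variable R : realType.
Local Notation plane := 'rV[R]_2.
Implicit Types (p q x y z u v w : plane) (r s t : R).

Lemma nbhs_dsq p (N : set plane) :
  nbhs p N <-> exists2 r, 0 < r & forall y, dsq y p < r -> N y.
Proof.
split=> [/nbhs_ballP[e /= e0 he]|[r r0 hr]].
  exists (e ^+ 2); first by rewrite exprn_gt0.
  move=> y hy; apply: he; split=> // i j; rewrite (ord1 i) /ball /= distrC -ltr_sqr ?nnegrE ?normr_ge0 ?(ltW e0) //.
  apply: le_lt_trans hy; rewrite real_normK ?num_real // /dsq /px /py.
  case: j => -[|[|//]] hj.
    by rewrite (_ : Ordinal hj = ord0) ?lerDl ?sqr_ge0 //; apply: val_inj.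
  by rewrite (_ : Ordinal hj = ord_max) ?lerDr ?sqr_ge0 //; apply: val_inj.
apply/nbhs_ballP; exists (Num.sqrt (r / 2)) => /=; first by rewrite sqrtr_gt0 divr_gt0.
move=> y hy; apply: hr; rewrite [ltRHS](splitr r) /dsq.
have h i : (y ord0 i - p ord0 i) ^+ 2 < r / 2.
  rewrite -[ltRHS]sqr_sqrtr ?divr_ge0 ?ltW // -real_normK ?num_real //.
  by rewrite ltr_sqr ?nnegrE ?sqrtr_ge0 // distrC; apply: hy.2.
by rewrite ltrD // h.
Qed.

Lemma px_continuous : continuous (@px R).
Proof. exact: coord_continuous. Qed.

Lemma py_continuous : continuous (@py R).
Proof. exact: coord_continuous. Qed.

Lemma coord_sub_continuous (h : plane -> R) c :
  continuous h -> continuous (fun y => h y - c).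
Proof.
move=> hc y; have H : {for y, continuous (h - cst c)}.
  by apply: continuousB; [exact: hc|exact: cst_continuous].
exact: H.
Qed.

Lemma dsq_continuous p : continuous (fun y => dsq y p).
Proof.
move=> y; have hx := @coord_sub_continuous _ (px p) px_continuous y.
have hy := @coord_sub_continuous _ (py p) py_continuous y.
exact: (@continuousD R R^o _ _ _ y (continuousM hx hx) (continuousM hy hy)).
Qed.

Lemma cross_continuous u p : continuous (fun y : plane => cross u (y - p)).
Proof.
move=> y; have hx := @coord_sub_continuous _ (px p) px_continuous y.
have hy := @coord_sub_continuous _ (py p) py_continuous y.
have -> : (fun y : plane => cross u (y - p)) =
    (cst (px u) \* (fun y => py y - py p)) - (cst (py u) \* (fun y => px y - px p)).
  by apply/funext => z; rewrite /cross !coordE.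
by apply: continuousB; apply: continuousM => //; exact: cst_continuous.
Qed.

Lemma open_ball_dsq p x r : dsq x p < r ->
  exists2 r', 0 < r' & forall y, dsq y x < r' -> dsq y p < r.
Proof.
move=> h; have N : nbhs (dsq x p) [set t | t < r].
  by apply: open_nbhs_nbhs; split=> //; exact: open_lt.
by have [r' r'0 hr'] := (nbhs_dsq _ _).1 (@dsq_continuous p x _ N); exists r'.
Qed.

Lemma convex_ball_dsq q u v r s : 0 <= s <= 1 -> dsq u q < r -> dsq v q < r ->
  dsq (u + s *: (v - u)) q < r.
Proof.
move=> /andP[s0 s1] hu hv; rewrite dsqC stewart !(dsqC q).
have h1 : 0 <= s * (1 - s) * dsq u v by rewrite !mulr_ge0 ?dsq_ge0 ?subr_ge0.
apply: (@le_lt_trans _ _ ((1 - s) * dsq u q + s * dsq v q)); first by rewrite gerBl.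
set m := Num.max (dsq u q) (dsq v q).
apply: (@le_lt_trans _ _ m); last by rewrite gt_max hu.
rewrite [leRHS](_ : _ = (1 - s) * m + s * m); last by ring.
by rewrite lerD // ler_wpM2l ?subr_ge0 // le_max lexx ?orbT.
Qed.

(** Source of all later small displacements: with [D] the squared length of [v], the multiples of
    [v] by at most [e] stay in the disc of squared radius [r]. Dividing by [D + 1] allows
    [D = 0]. *)
Lemma small_scale r D m : 0 < r -> 0 <= D -> 0 < m ->
  exists2 e, 0 < e <= m & forall t, `|t| <= e -> t ^+ 2 * D < r.
Proof.
move=> r0 D0 m0; have D1 : 0 < D + 1 by rewrite ltr_wpDl.
pose e := Num.min m (Num.min 1 (r / (D + 1))); exists e.
  by rewrite !lt_min m0 ltr01 divr_gt0 //= ge_min lexx.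
move=> t te; have e1 : e <= 1 by rewrite !ge_min lexx orbT.
have er : e <= r / (D + 1) by rewrite !ge_min lexx !orbT.
have t2 : t ^+ 2 <= r / (D + 1).
  rewrite -real_normK ?num_real // expr2; apply: le_trans er.
  by rewrite -[leRHS]mul1r; apply: ler_pM => //; apply: le_trans e1.
apply: le_lt_trans (ler_wpM2r D0 t2) _.
by rewrite mulrAC ltr_pdivrMr // ltr_pM2l // ltrDl.
Qed.

End Neighbourhoods.

(** * Lipschitz bound, contact sets and the sheets near a point *)

Section LocalStructure.
Variable R : realType.
Local Notation plane := 'rV[R]_2.
Variables (phi : plane -> plane) (fold : local_flat_folding phi).
Implicit Types (p q x y z u v w e : plane) (r s t : R) (f g : plane -> plane).

(** The remnant of isometry common to the three types of points: only distances to [p] itself are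
    kept. *)
Definition radial_at p r : Prop :=
  0 < r /\ forall y, dsq y p < r -> dsq (phi y) (phi p) = dsq y p.

Lemma radial_exists p : exists r, radial_at p r.
Proof.
have cover k N (A : 'I_k -> set plane) (f : 'I_k -> plane -> plane) :
    isometric_cover phi p N A f -> exists r, radial_at p r.
  move=> [/nbhs_dsq[r r0 hr] NE hA]; exists r; split=> // y /hr.
  rewrite NE => -[i _ Aiy]; have [Aip iso hf] := hA i.
  by rewrite (hf _ Aiy) (hf _ Aip) iso_dsq.
have [_ /(_ p) types _] := fold.
case: types => [|[_ [N [A [f [+ _]]]]]|[_ _ [N [k [A [f [_ + _]]]]]]].
- move=> [N /nbhs_dsq[r r0 hr] dN]; exists r; split=> // y hy.
  apply/eqP; rewrite -eqr_sqrt ?dsq_ge0 // -!eucl_distE dN //; apply: hr => //.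
  by rewrite dsqxx.
- exact: cover.
- exact: cover.
Qed.

(** Travel along the segment: around each of its points distances to that point are kept, so the
    triangle inequality carries the bound up to the point and a little beyond it. *)
Lemma lipschitz x y : dsq (phi x) (phi y) <= dsq x y.
Proof.
pose v := y - x.
suff h s : 0 <= s -> dsq (phi (x + s *: v)) (phi x) <= s ^+ 2 * dsq v 0.
  by have := h 1 ler01; rewrite scale1r expr1n mul1r -dsq_sub /v addrC subrK dsqC (dsqC y).
move: s; apply: real_induction => [|s s0 hs|s s0 hs].
- by rewrite scale0r addr0 dsqxx expr0n mul0r.
- have [r [r0 hr]] := radial_exists (x + s *: v).
  have [e /andP[e0 es] he] := small_scale r0 (dsq_ge0 v 0) s0.
  have hse : dsq (x + (s - e) *: v) (x + s *: v) = e ^+ 2 * dsq v 0.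
    by rewrite dsq_along; congr (_ * _); ring.
  rewrite -[in leRHS](subrK e s) [_ - _ + _]addrC.
  apply: (@dsq_triangle _ _ _ _ _ (phi (x + (s - e) *: v))); rewrite ?subr_ge0 ?(ltW e0) //.
    by rewrite dsqC hr hse // he // gtr0_norm.
  by apply: hs; rewrite subr_ge0 es gtrBl.
- have [r [r0 hr]] := radial_exists (x + s *: v).
  have [e /andP[e0 es] he] := small_scale r0 (dsq_ge0 v 0) ltr01.
  exists e => // t /andP[st te].
  have hst : dsq (x + t *: v) (x + s *: v) = (t - s) ^+ 2 * dsq v 0.
    by rewrite dsq_along.
  rewrite -[in leRHS](subrK s t).
  apply: (@dsq_triangle _ _ _ _ _ (phi (x + s *: v))); rewrite ?subr_ge0 ?(ltW st) //.
    rewrite hr hst // he // gtr0_norm ?subr_gt0 //.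
    by rewrite lerBlDl ltW.
  by apply: hs; rewrite s0 lexx.
Qed.

Lemma contact_segment f x y t : plane_isometry f -> phi x = f x -> phi y = f y ->
  0 <= t <= 1 -> phi (x + t *: (y - x)) = f (x + t *: (y - x)).
Proof.
move=> iso ex ey t01; rewrite (iso_affine iso).
apply: (between_rigid t01 (D := dsq x y)); first by rewrite (iso_dsq iso).
  by rewrite -ex (le_trans (lipschitz _ _)) // dsq_base -dsq_sub dsqC.
rewrite -ey (le_trans (lipschitz _ _)) // [leRHS](_ : _ = dsq (x + t *: (y - x)) y) //.
by rewrite /dsq !coordE; ring.
Qed.

Lemma contact_ray f q v t : plane_isometry f -> phi q = f q -> phi (q + v) = f (q + v) ->
  0 <= t <= 1 -> phi (q + t *: v) = f (q + t *: v).
Proof.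
move=> iso eq ev t01; have := contact_segment iso eq ev t01.
by rewrite [q + v]addrC addrK.
Qed.

Lemma contact_closed f y : plane_isometry f -> phi y <> f y ->
  exists2 r, 0 < r & forall w, dsq w y < r -> phi w <> f w.
Proof.
(* A contact at [w] would put [phi y] within twice the distance from [w] to [y] of [f y], hence 4
   for squares. *)
move=> iso ne; exists (dsq (phi y) (f y) / 4).
  by rewrite divr_gt0 ?dsq_gt0 //; apply/eqP.
move=> w hw ew; have : dsq (phi y) (f y) <= (1 + 1) ^+ 2 * dsq w y.
  apply: (@dsq_triangle _ _ _ _ _ (phi w)); rewrite ?ler01 // expr1n mul1r.
    by rewrite (dsqC w) lipschitz.
  by rewrite ew (iso_dsq iso).
lra.
Qed.

Lemma unfolded_near x : unfolded_point phi x -> exists2 r, 0 < r &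
  forall y z, dsq y x < r -> dsq z x < r -> dsq (phi y) (phi z) = dsq y z.
Proof.
move=> [N /nbhs_dsq[r r0 hr] dN]; exists r => // y z hy hz.
by apply/eqP; rewrite -eqr_sqrt ?dsq_ge0 // -!eucl_distE dN //; apply: hr.
Qed.

Lemma flat_unfolded f x r : plane_isometry f -> 0 < r ->
  (forall y, dsq y x < r -> phi y = f y) -> unfolded_point phi x.
Proof.
move=> iso r0 hr; exists [set y | dsq y x < r]; first by apply/nbhs_dsq; exists r.
by move=> y z hy hz; rewrite !hr //; apply: iso.
Qed.

Lemma unfolded_open x : unfolded_point phi x ->
  exists2 r, 0 < r & forall y, dsq y x < r -> unfolded_point phi y.
Proof.
move=> [N /nbhs_dsq[r r0 hr] dN]; exists r => // y hy.
by exists N => //; apply/nbhs_dsq; have [r' r'0 hr'] := open_ball_dsq hy; exists r' => // z /hr'/hr.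
Qed.

(** Convexity of the contact set pulls the possibly distant [y] and [z] into the unfolded disc,
    where three non-collinear contacts determine every image. *)
Lemma unfolded_flat f x y z : plane_isometry f -> unfolded_point phi x ->
  phi x = f x -> phi y = f y -> phi z = f z -> cross (y - x) (z - x) != 0 ->
  exists2 r, 0 < r & forall w, dsq w x < r -> phi w = f w.
Proof.
move=> iso /unfolded_near[r r0 hr] ex ey ez nc; exists r => // w hw.
have D0 := addr_ge0 (dsq_ge0 (y - x) 0) (dsq_ge0 (z - x) 0).
have [e /andP[e0 e1] he] := small_scale r0 D0 ltr01.
have hb a : dsq (a - x) 0 <= dsq (y - x) 0 + dsq (z - x) 0 -> phi a = f a ->
    dsq (phi w) (f (x + e *: (a - x))) = dsq w (x + e *: (a - x)).
  move=> ha ea; rewrite -(contact_segment iso ex ea) ?e1 ?ltW //.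
  apply: hr => //; rewrite dsq_base; apply: le_lt_trans (he e _); last by rewrite gtr0_norm.
  by rewrite ler_wpM2l // sqr_ge0.
apply: (@iso_trilateration _ _ iso x (x + e *: (y - x)) (x + e *: (z - x))).
- rewrite (_ : cross _ _ = e ^+ 2 * cross (y - x) (z - x)); last first.
    by rewrite /cross !coordE; ring.
  by rewrite mulf_eq0 negb_or nc expf_neq0 // gt_eqF.
- by rewrite -ex hr // dsqxx.
- by apply: hb => //; rewrite lerDl dsq_ge0.
- by apply: hb => //; rewrite lerDr dsq_ge0.
Qed.

Lemma two_sheets f g x r : plane_isometry f -> plane_isometry g ->
  phi x = f x -> phi x = g x -> 0 < r ->
  (forall y, dsq y x < r -> phi y = f y \/ phi y = g y) ->
  unfolded_point phi x \/ crease_point phi x.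
Proof.
move=> isof isog ef eg r0 hr; have [?|nu] := pselect (unfolded_point phi x); [by left|right].
split=> //.
pose F (i : 'I_2) := if i == ord0 then f else g.
have F1 : F ord_max = g by [].
exists [set y | phi y = f y \/ phi y = g y], (fun i => [set y | phi y = F i y]), F.
split; last first.
  rewrite F1 => fg; apply: nu; apply: (flat_unfolded isof r0) => y /hr.
  by rewrite -fg => -[].
split.
- by apply/nbhs_dsq; exists r.
- apply/seteqP; split=> y /=.
    by move=> [h|h]; [exists ord0|exists ord_max].
  by move=> [i _]; rewrite /= /F; case: ifP; [left|right].
- by move=> i; rewrite /= /F; case: ifP.
Qed.

Lemma two_sheets_near f p x r : plane_isometry f -> radial_at p r -> p != x ->
  dsq x p < r -> phi p = f p -> phi x = f x ->
  exists2 r', 0 < r' & forall y, dsq y x < r' -> phi y = f y \/ phi y = f (refl p x y).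
Proof.
move=> iso [r0 hr] px_neq xp ep ex.
have [r1 r10 hr1] := open_ball_dsq xp; have [r2 [r20 hr2]] := radial_exists x.
exists (Num.min r1 r2); first by rewrite lt_min r10.
move=> y; rewrite lt_min => /andP[/hr1 hy1 hy2]; apply: iso_two => //.
  by rewrite -ep hr.
by rewrite -ex hr2.
Qed.

Lemma punctured_unfolded_or_crease p x r : radial_at p r -> p != x -> dsq x p < r ->
  unfolded_point phi x \/ crease_point phi x.
Proof.
move=> rad px_neq xp; have [f [iso fp fx]] := iso_extend px_neq (rad.2 _ xp).
have [r' r'0 hr'] := two_sheets_near iso rad px_neq xp (esym fp) (esym fx).
apply: (two_sheets iso (iso_comp iso (refl_iso px_neq)) _ _ r'0 hr') => //.
by rewrite /= reflx.
Qed.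

(* On the side of the line px where y lies, the mirror sheet would bring images
   too far from that of y. *)
Lemma contact_side f p x y r : plane_isometry f -> radial_at p r -> p != x ->
  dsq x p < r -> phi p = f p -> phi x = f x -> phi y = f y ->
  exists2 r', 0 < r' & forall w, dsq w x < r' ->
    0 < cross (x - p) (w - p) * cross (x - p) (y - p) -> phi w = f w.
Proof.
move=> iso rad pxn xp ep ex ey.
have [r' r'0 hr'] := two_sheets_near iso rad pxn xp ep ex; exists r' => // w /hr'[//|hw] h.
have d0 : 0 < dsq x p by rewrite dsq_gt0 // eq_sym.
have := lipschitz w y; rewrite hw ey (iso_dsq iso) dsq_refl // gerDl leNgt => /negP[].
by rewrite divr_gt0 // -mulrA mulr_gt0.
Qed.

(** A contact on each side of the line [px] excludes the mirror sheet there, and on the line the two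
    sheets agree. *)
Lemma contact_both_sides f p x y z r : plane_isometry f -> radial_at p r ->
  p != x -> dsq x p < r -> phi p = f p -> phi x = f x -> phi y = f y ->
  phi z = f z -> cross (x - p) (y - p) * cross (x - p) (z - p) < 0 ->
  unfolded_point phi x.
Proof.
move=> iso rad pxn xp ep ex ey ez yz.
have [r0 r00 h0] := two_sheets_near iso rad pxn xp ep ex.
have [r1 r10 h1] := contact_side iso rad pxn xp ep ex ey.
have [r2 r20 h2] := contact_side iso rad pxn xp ep ex ez.
apply: (@flat_unfolded f x (Num.min r0 (Num.min r1 r2))) => //.
  by rewrite !lt_min r00 r10.
move=> w; rewrite !lt_min => /and3P[/h0 {}h0 /h1 {}h1 /h2 {}h2].
case: (ltgtP (cross (x - p) (y - p)) 0) yz => hy; last by rewrite hy mul0r ltxx.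
- rewrite nmulr_rlt0 // => hz.
  case: (ltgtP (cross (x - p) (w - p)) 0) => hw.
  + by apply: h1; rewrite nmulr_rgt0.
  + by apply: h2; rewrite pmulr_rgt0.
  + by case: h0; rewrite // refl_id.
- rewrite pmulr_rlt0 // => hz.
  case: (ltgtP (cross (x - p) (w - p)) 0) => hw.
  + by apply: h2; rewrite nmulr_rgt0.
  + by apply: h1; rewrite pmulr_rgt0.
  + by case: h0; rewrite // refl_id.
Qed.

End LocalStructure.

(** * Creases are locally straight *)

Section Creases.
Variable R : realType.
Local Notation plane := 'rV[R]_2.
Variables (phi : plane -> plane) (fold : local_flat_folding phi).
Implicit Types (p q x y z u v w e : plane) (r s t : R) (f g : plane -> plane).

Lemma crossC u v : cross u v = - cross v u.
Proof. by rewrite /cross; ring. Qed.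

Lemma cross_perp v : cross v (perp v) = dsq v 0.
Proof. by rewrite /cross px_perp py_perp /dsq !coordE; ring. Qed.

Lemma crossZl t u v : cross (t *: u) v = t * cross u v.
Proof. by rewrite /cross !coordE; ring. Qed.

Lemma crossZr t u v : cross u (t *: v) = t * cross u v.
Proof. by rewrite /cross !coordE; ring. Qed.

Lemma crossDr u v w : cross u (v + w) = cross u v + cross u w.
Proof. by rewrite /cross !coordE; ring. Qed.

Lemma crossNr u v : cross u (- v) = - cross u v.
Proof. by rewrite /cross !coordE; ring. Qed.

Lemma crossNl u v : cross (- u) v = - cross u v.
Proof. by rewrite /cross !coordE; ring. Qed.

Lemma addv_neq q v : (q != q + v) = (v != 0).
Proof. by rewrite eq_sym -subr_eq0 addrAC subrr add0r. Qed.

Lemma dsq_addl q v : dsq (q + v) q = dsq v 0.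
Proof. by rewrite dsq_sub addrAC subrr add0r. Qed.

Lemma dsqZ t v : dsq (t *: v) 0 = t ^+ 2 * dsq v 0.
Proof. by rewrite /dsq !coordE; ring. Qed.

(** Some isometry is matched on the whole segment from [q] to [q + v]; it and [f] are affine there,
    so one common value besides [q] makes them agree at the end. *)
Lemma contact_extend f q v t r : radial_at phi q r -> dsq (q + v) q < r ->
  plane_isometry f -> phi q = f q -> 0 < t <= 1 ->
  phi (q + t *: v) = f (q + t *: v) -> phi (q + v) = f (q + v).
Proof.
move=> rad vr iso eq /andP[t0 t1] et.
have [->|v0] := eqVneq v 0; first by rewrite addr0.
have qv : q != q + v by rewrite addv_neq.
have [g [isog gq gv]] := iso_extend qv (rad.2 _ vr).
have t01 : 0 <= t <= 1 by rewrite ltW.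
have := contact_ray fold isog (esym gq) (esym gv) t01.
rewrite et (iso_ray iso) (iso_ray isog) gq gv eq => /addrI /scalerI.
by rewrite gt_eqF // => /(_ isT) /addIr.
Qed.

Lemma sq_le1 t : 0 <= t <= 1 -> t ^+ 2 <= 1.
Proof. by move=> /andP[t0 t1]; rewrite expr_le1. Qed.

(** A flat disc around an unfolded [q + t *: v], dilated from [q] by 1/t with [contact_extend],
    would be a flat disc around [q + v]. *)
Lemma crease_ray q v t r : radial_at phi q r -> dsq (q + v) q < r ->
  crease_point phi (q + v) -> 0 < t <= 1 -> crease_point phi (q + t *: v).
Proof.
move=> rad vr cr t01; have /andP[t0 t1] := t01.
have [v0|v0] := eqVneq v 0; first by move: cr; rewrite v0 scaler0.
have tv0 : t *: v != 0 by rewrite scaler_eq0 negb_or v0 gt_eqF.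
have qtv : q != q + t *: v by rewrite addv_neq.
have qv : q != q + v by rewrite addv_neq.
have tvr : dsq (q + t *: v) q < r.
  apply: le_lt_trans vr; rewrite !dsq_addl dsqZ ler_piMl ?dsq_ge0 //.
  by rewrite sq_le1 // ltW.
case: (punctured_unfolded_or_crease fold rad qtv tvr) => // unf; exfalso.
have [g [isog gq gtv]] := iso_extend qtv (rad.2 _ tvr).
have [r1 r10 h1] := two_sheets_near fold isog rad qtv tvr (esym gq) (esym gtv).
have [d /andP[d0 _] hd] := small_scale r10 (dsq_ge0 (perp v) 0) ltr01.
pose w := q + t *: v + d *: perp v.
have wr : dsq w (q + t *: v) < r1 by rewrite dsq_addl dsqZ hd // gtr0_norm.
have [f [iso eq et ew]] : exists f, [/\ plane_isometry f, phi q = f q,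
    phi (q + t *: v) = f (q + t *: v) & phi w = f w].
  case: (h1 w wr) => hw; first by exists g.
  exists (g \o refl q (q + t *: v)); split=> //=; rewrite ?reflp ?reflx //.
  exact: iso_comp isog (refl_iso qtv).
have nc : cross (q - (q + t *: v)) (w - (q + t *: v)) != 0.
  rewrite (_ : cross _ _ = - (t * d * cross v (perp v))).
    by rewrite oppr_eq0 cross_perp !mulf_neq0 ?gt_eqF // dsq_gt0.
  by rewrite /w /cross !coordE; ring.
have [r2 r20 h2] := unfolded_flat fold iso unf et eq ew nc.
have [r3 r30 h3] := open_ball_dsq vr.
case: cr => nunf _; apply: nunf.
apply: (@flat_unfolded _ phi f (q + v) (Num.min r2 r3)) => //; first by rewrite lt_min r20.
move=> y; rewrite lt_min => /andP[y2 /h3 y3].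
have -> : y = q + (y - q) by rewrite addrC subrK.
apply: (contact_extend rad _ iso eq t01); first by rewrite addrC subrK.
apply: h2; apply: le_lt_trans y2.
rewrite (_ : dsq _ _ = t ^+ 2 * dsq y (q + v)); last by rewrite /dsq !coordE; ring.
by rewrite ler_piMl ?dsq_ge0 // sq_le1 // ltW.
Qed.

Lemma crease_line x : crease_point phi x -> exists2 r, 0 < r &
  forall y z, y != x -> dsq y x < r -> dsq z x < r -> crease_point phi y ->
    cross (y - x) (z - x) = 0 ->
    crease_point phi z /\
    forall f, plane_isometry f -> phi x = f x -> phi y = f y -> phi z = f z.
Proof.
move=> [_ [N [A [F [[/nbhs_dsq[r r0 hr] NE hA] F01]]]]]; exists r => //.
pose f := F ord0; pose g := F ord_max.
have [_ + fA] := hA ord0; have [_ + gA] := hA ord_max.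
rewrite -/f -/g => isog isof.
have sheets w : dsq w x < r -> phi w = f w \/ phi w = g w.
  move=> /hr; rewrite NE => -[[[|[|//]] i] _].
    by rewrite (_ : Ordinal i = ord0); [left; apply: fA|apply: val_inj].
  by rewrite (_ : Ordinal i = ord_max); [right; apply: gA|apply: val_inj].
have fx : phi x = f x by apply: fA; case: (hA ord0).
have gx : phi x = g x by apply: gA; case: (hA ord_max).
move=> y z yx yr zr cy coll; have xy : x != y by rewrite eq_sym.
have [ry ry0 hry] := open_ball_dsq yr.
(* Both sheets occur near every crease point in the ball. *)
have off (h : plane -> plane) : plane_isometry h ->
    exists2 w, dsq w x < r & phi w <> h w.
  move=> isoh; apply: contrapT => hn; apply: cy.1.
  apply: (flat_unfolded isoh ry0) => w /hry wr.
  by apply: contrapT => nw; apply: hn; exists w.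
have on (h k : plane -> plane) : plane_isometry h -> plane_isometry k ->
    (forall w, dsq w x < r -> phi w = h w \/ phi w = k w) -> phi y = h y.
  move=> isoh isok hk; apply: contrapT => /(contact_closed fold isoh)[r1 r10 h1].
  apply: cy.1; apply: (@flat_unfolded _ phi k y (Num.min r1 ry)) => //.
    by rewrite lt_min r10.
  by move=> w; rewrite lt_min => /andP[/h1 nw /hry /hk[]].
have fy : phi y = f y by exact: (on f g).
have gy : phi y = g y by apply: (on g f) => // w /sheets[]; [right|left].
have agree h k w : plane_isometry h -> plane_isometry k -> phi x = h x ->
    phi x = k x -> phi y = h y -> phi y = k y -> cross (y - x) (w - x) = 0 -> h w = k w.
  move=> isoh isok hx kx hy ky hw; apply: (iso_line isok xy hw).
    by rewrite -kx hx (iso_dsq isoh).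
  by rewrite -ky hy (iso_dsq isoh).
have fgz : f z = g z by apply: agree.
have ez : phi z = f z /\ phi z = g z by case: (sheets z zr); rewrite fgz.
split; last first.
  by move=> h isoh hx hy; rewrite ez.1; apply: agree.
have [rz rz0 hrz] := open_ball_dsq zr.
case: (two_sheets isof isog ez.1 ez.2 rz0) => //; first by move=> w /hrz/sheets.
move=> unf; exfalso.
(* [w] is only on the sheet [g] and [w'] only on [f], so both are off the line. *)
have [w wr nw] := off f isof; have [w' w'r nw'] := off g isog.
have gw : phi w = g w by case: (sheets w wr).
have fw' : phi w' = f w' by case: (sheets w' w'r).
have wl : cross (y - x) (w - x) != 0.
  by apply/eqP => h; apply: nw; rewrite gw; apply: agree.
have w'l : cross (y - x) (w' - x) != 0.
  by apply/eqP => h; apply: nw'; rewrite fw'; apply: agree.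
have flat : exists2 r1, 0 < r1 & forall v, dsq v z < r1 -> phi v = g v.
  have [cx0|cx] := eqVneq (cross (x - z) (w - z)) 0; last first.
    exact: (unfolded_flat fold isog unf ez.2 gx gw cx).
  have [cy0|cy'] := eqVneq (cross (y - z) (w - z)) 0; last first.
    exact: (unfolded_flat fold isog unf ez.2 gy gw cy').
  exfalso; move/eqP: wl; apply.
  rewrite (_ : cross _ _ = cross (y - z) (w - z) - cross (x - z) (w - z) + cross (y - x) (z - x)).
    by rewrite cx0 cy0 coll subrr addr0.
  by rewrite /cross !coordE; ring.
have [r1 r10 h1] := flat.
have [t /andP[t0 t1] ht] := small_scale r10 (dsq_ge0 (w' - z) 0) ltr01.
(* The shared point off the line: on [f] because it lies between [z] and [w'], on [g] because it is
   in the flat disc around [z]. *)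
pose u := z + t *: (w' - z).
have fu : phi u = f u by apply: contact_segment => //; [exact: ez.1|rewrite ltW].
have gu : phi u = g u by apply: h1; rewrite dsq_addl dsqZ ht // gtr0_norm.
have ul : cross (y - x) (u - x) != 0.
  rewrite (_ : cross _ _ = (1 - t) * cross (y - x) (z - x) + t * cross (y - x) (w' - x)).
    by rewrite coll mulr0 add0r mulf_neq0 // gt_eqF.
  by rewrite /u /cross !coordE; ring.
apply: nw; rewrite gw; apply: (iso_trilateration isof ul).
- by rewrite -fx gx (iso_dsq isog).
- by rewrite -fy gy (iso_dsq isog).
- by rewrite -fu gu (iso_dsq isog).
Qed.

End Creases.

(** * Creases leaving a vertex point *)

Section Vertices.
Variable R : realType.
Local Notation plane := 'rV[R]_2.
Variables (phi : plane -> plane) (fold : local_flat_folding phi).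
Implicit Types (p q x y z u v w e : plane) (r s t : R) (f g : plane -> plane).

Lemma cross_neq0l u v : cross u v != 0 -> u != 0.
Proof. by apply: contraNneq => ->; rewrite /cross !coordE !mul0r subrr. Qed.

Lemma closed_along f a v s : plane_isometry f -> 0 < s ->
  (forall t, 0 <= t < s -> phi (a + t *: v) = f (a + t *: v)) ->
  phi (a + s *: v) = f (a + s *: v).
Proof.
move=> iso s0 h; apply: contrapT => /(contact_closed fold iso)[r r0 hr].
have [d /andP[d0 ds] hd] := small_scale r0 (dsq_ge0 v 0) s0.
apply: (hr (a + (s - d) *: v)).
  by rewrite dsq_along (_ : s - d - s = - d) ?sqrrN ?hd ?gtr0_norm //; ring.
by apply: h; rewrite subr_ge0 ds gtrBl.
Qed.

(** [m] cannot be parallel to both [u] and [w], so one of them completes [q] and [q + m] to three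
    non-collinear contacts. *)
Lemma unfolded_cone f q u w m : plane_isometry f -> unfolded_point phi (q + m) ->
  phi q = f q -> phi (q + u) = f (q + u) -> phi (q + w) = f (q + w) ->
  phi (q + m) = f (q + m) -> cross u w != 0 -> m != 0 ->
  exists2 r, 0 < r & forall y, dsq y (q + m) < r -> phi y = f y.
Proof.
move=> iso unf eq eu ew em uw m0.
have [mu|mu] := eqVneq (cross m u) 0; last first.
  apply: (unfolded_flat fold iso unf em eq eu).
  rewrite (_ : cross _ _ = - cross m u) ?oppr_eq0 //; rewrite /cross !coordE; ring.
apply: (unfolded_flat fold iso unf em eq ew).
have -> : cross (q - (q + m)) (q + w - (q + m)) = - cross m w.
  by rewrite /cross !coordE; ring.
rewrite oppr_eq0; apply: contraNneq m0 => mw.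
have h1 : cross u w *: m = cross m w *: u - cross m u *: w.
  by apply: plane_eq; rewrite /cross !coordE; ring.
by move/eqP: h1; rewrite mw mu !scale0r subrr scaler_eq0 (negPf uw).
Qed.

(** Without such a crease, contact with [f] would spread over the half plane to two boundary points
    symmetric about [q]. Near [q] only [f] and one mirror sheet would then remain, which is no
    vertex point. *)
Lemma crease_in_contact f q e u w r : vertex_point phi q -> radial_at phi q r ->
  plane_isometry f -> phi q = f q -> phi (q + u) = f (q + u) ->
  phi (q + w) = f (q + w) -> cross u w != 0 -> 0 < cross e u ->
  exists v, [/\ 0 < cross e v, dsq (q + v) q < r, phi (q + v) = f (q + v)
              & crease_point phi (q + v)].
Proof.
move=> [nunf ncr _] rad iso eq eu ew uw eu0; apply: contrapT => none.
have [r0 _] := rad.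
have D0 : 0 <= dsq u 0 + dsq w 0 + dsq e 0 by rewrite addr_ge0 ?dsq_ge0 // addr_ge0 ?dsq_ge0.
have [k /andP[k0 k1] hk] := small_scale r0 D0 ltr01.
have k01 : 0 <= k <= 1 by rewrite ltW.
have small v : dsq v 0 <= dsq u 0 + dsq w 0 + dsq e 0 -> dsq (k *: v) 0 < r.
  move=> hv; rewrite dsqZ; apply: le_lt_trans (hk k _); last by rewrite gtr0_norm.
  by rewrite ler_wpM2l // sqr_ge0.
have kur : dsq (k *: u) 0 < r by apply: small; rewrite -addrA lerDl addr_ge0 ?dsq_ge0.
have ker : dsq (k *: e) 0 < r by apply: small; rewrite lerDr addr_ge0 ?dsq_ge0.
have e0 : e != 0 by apply: cross_neq0l (lt0r_neq0 eu0).
(* On the way straight from [q + k *: u] to [q + c], every point before the end is in the open half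
   plane, hence unfolded as long as contact lasts. *)
have boundary c : dsq c 0 < r -> cross e c = 0 -> phi (q + c) = f (q + c).
  move=> cr ec; pose d := c - k *: u.
  suff h s : 0 <= s -> s <= 1 -> phi (q + k *: u + s *: d) = f (q + k *: u + s *: d).
    by have := h 1 ler01 (lexx 1); rewrite scale1r -addrA /d (addrC (k *: u)) subrK.
  move: s; apply: real_induction => [_|s s0 hs s1|s s0 hs].
  - by rewrite scale0r addr0; apply: contact_ray.
  - apply: closed_along => // t /andP[t0 ts]; apply: hs; rewrite ?t0 //.
    by apply: le_trans s1; apply: ltW.
  - have [s1|s1] := ltP s 1; last first.
      by exists 1 => // t /andP[st _] t1; move: (lt_le_trans st t1); rewrite ltNge s1.
    pose m := k *: u + s *: d.
    have em : phi (q + m) = f (q + m).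
      by rewrite /m addrA; apply: hs; rewrite ?s0 ?lexx // ltW.
    have mpos : 0 < cross e m.
      rewrite (_ : cross e m = (1 - s) * (k * cross e u) + s * cross e c).
        by rewrite ec mulr0 addr0 !mulr_gt0 // subr_gt0.
      by rewrite /m /d /cross !coordE; ring.
    have m0 : m != 0.
      by apply: contraTneq mpos => ->; rewrite cross0r ltxx.
    have mr : dsq (q + m) q < r.
      by rewrite dsq_addl /m; apply: convex_ball_dsq => //; rewrite s0 ltW.
    have qm : q != q + m by rewrite addv_neq.
    case: (punctured_unfolded_or_crease fold rad qm mr) => [unf|cm]; last first.
      by case: none; exists m.
    have [r' r'0 hr'] := unfolded_cone iso unf eq eu ew em uw m0.
    have [t0 /andP[t00 _] ht0] := small_scale r'0 (dsq_ge0 d 0) ltr01.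
    exists t0 => // t /andP[st ts] _; apply: hr'.
    rewrite /m addrA dsq_along ht0 // gtr0_norm ?subr_gt0 //.
    by rewrite lerBlDl ltW.
have eke : cross e (k *: e) = 0 by rewrite crossZr crossvv mulr0.
have ep := boundary _ ker eke.
have em : phi (q - k *: e) = f (q - k *: e).
  apply: boundary; last by rewrite crossNr eke oppr0.
  by rewrite -scaleN1r dsqZ sqrrN expr1n mul1r.
have qe : q != q + k *: e by rewrite addv_neq scaler_eq0 negb_or gt_eqF.
(* Parallelogram law: the distance to [q] fixes the sum of these squares, so the Lipschitz bounds
   towards the two boundary points are equalities. *)
have mid z : dsq z (q + k *: e) + dsq z (q - k *: e)
   = 2 * dsq z q + 2 * dsq (k *: e) 0.
  by rewrite /dsq !coordE; ring.
have midf z : dsq z (f (q + k *: e)) + dsq z (f (q - k *: e))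
   = 2 * dsq z (f q) + 2 * dsq (k *: e) 0.
  rewrite -[- (k *: e)]scaleN1r (iso_ray iso q (k *: e)) -(dsq_addl q) -(iso_dsq iso (q + _)).
  by rewrite /dsq !coordE; ring.
suff h y : dsq y q < r -> phi y = f y \/ phi y = (f \o refl q (q + k *: e)) y.
  case: (two_sheets iso (iso_comp iso (refl_iso qe)) eq _ r0 h) => //.
  by rewrite /= reflp.
move=> yr; apply: (iso_two iso qe); first by rewrite -eq rad.2.
have h1 : dsq (phi y) (f (q + k *: e)) <= dsq y (q + k *: e) by rewrite -ep lipschitz.
have h2 : dsq (phi y) (f (q - k *: e)) <= dsq y (q - k *: e) by rewrite -em lipschitz.
have := mid y; have := midf (phi y); rewrite -eq rad.2 //.
move: h1 h2; set A := dsq (phi y) _; set B := dsq (phi y) _; set C := dsq y _.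
set D := dsq y _ => *; lra.
Qed.

(** Provides a sheet for [crease_in_contact]: [u] is normal to [e], [w] is [u] shifted along [e],
    and of the two sheets at [q + u] the one holding at [q + w] is taken. *)
Lemma vertex_crease q e r : vertex_point phi q -> radial_at phi q r -> e != 0 ->
  exists f v, [/\ plane_isometry f, phi q = f q, 0 < cross e v &
    [/\ dsq (q + v) q < r, phi (q + v) = f (q + v) & crease_point phi (q + v)]].
Proof.
move=> vq rad e0; have [r0 _] := rad.
have [k /andP[k0 k1] hk] := small_scale r0 (dsq_ge0 (perp e) 0) ltr01.
have ee : 0 < dsq e 0 by rewrite dsq_gt0.
pose u := k *: perp e; have ur : dsq (q + u) q < r by rewrite dsq_addl dsqZ hk // gtr0_norm.
have eu : 0 < cross e u by rewrite crossZr cross_perp mulr_gt0.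
have u0 : u != 0 by apply: contraTneq eu => ->; rewrite cross0r ltxx.
have qu : q != q + u by rewrite addv_neq.
have [g [isog gq gu]] := iso_extend qu (rad.2 _ ur).
have [r1 r10 h1] := two_sheets_near fold isog rad qu ur (esym gq) (esym gu).
have [d /andP[d0 _] hd] := small_scale r10 (dsq_ge0 e 0) ltr01.
pose w := u + d *: e.
have [f [iso eq et ew]] : exists f, [/\ plane_isometry f, phi q = f q,
    phi (q + u) = f (q + u) & phi (q + w) = f (q + w)].
  case: (h1 (q + w)) => [|hw|hw].
  - by rewrite /w addrA dsq_addl dsqZ hd // gtr0_norm.
  - by exists g.
  exists (g \o refl q (q + u)); split=> //=; rewrite ?reflp ?reflx //.
  exact: iso_comp isog (refl_iso qu).
have uw : cross u w != 0.
  rewrite /w crossDr crossvv add0r crossZr crossC mulrN oppr_eq0.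
  by rewrite mulf_neq0 // gt_eqF.
by have [v [? ? ? ?]] := crease_in_contact vq rad iso eq et ew uw eu; exists f, v.
Qed.

(** Real induction along the ray. A limit of creases is not unfolded, since unfolded points form an
    open set; if it is not a vertex point, [crease_line] continues crease and contact beyond it. *)
Lemma follow_crease f q v r : vertex_point phi q -> radial_at phi q r ->
  plane_isometry f -> phi q = f q -> dsq (q + v) q < r -> 
  phi (q + v) = f (q + v) -> crease_point phi (q + v) ->
  open_ray q v `<=` crease_point phi \/
  exists T, [/\ 0 < T, vertex_point phi (q + T *: v), phi (q + T *: v) = f (q + T *: v)
    & forall t, 0 < t < T -> crease_point phi (q + t *: v)].
Proof.
move=> vq rad iso eq vr ev cv.
have v0 : v != 0 by apply: contraPneq vq => v0; case=> _ + _; rewrite -[q]addr0 -v0.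
pose P t := phi (q + t *: v) = f (q + t *: v) /\ (0 < t -> crease_point phi (q + t *: v)).
have [[T [T0 vT hT]]|close] := pselect (exists T, [/\ 0 < T, vertex_point phi (q + T *: v)
    & forall t, 0 <= t < T -> P t]).
  right; exists T; split=> //; first by apply: closed_along => // t /hT[].
  by move=> t /andP[t0 tT]; have [|_] := hT t; rewrite ?ltW //; apply.
left=> _ [t /= t0 <-].
suff : P t by case=> _; apply.
move: t {t0} (ltW t0); apply: real_induction => [|s s0 hs|s s0 hs].
- by rewrite /P scale0r addr0 ltxx.
- have es : phi (q + s *: v) = f (q + s *: v) by apply: closed_along => // t /hs[].
  split=> // _; have [_ types _] := fold; case: (types (q + s *: v)) => // [unf|vs].
    have [r1 r10 h1] := unfolded_open unf.
    have [d /andP[d0 ds] hd] := small_scale r10 (dsq_ge0 v 0) s0.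
    have d2 : 0 < d / 2 by rewrite divr_gt0.
    have ds2 : 0 < s - d / 2 by lra.
    have [] := hs (s - d / 2); first by lra.
    move=> _ /(_ ds2)[]; case; apply: h1.
    rewrite dsq_along (_ : s - d / 2 - s = - (d / 2)); last by ring.
    by rewrite sqrrN hd // gtr0_norm //; lra.
  by case: close; exists s.
- move: s0; rewrite le0r => /predU1P[s0|s0].
    exists 1 => // t /andP[t0 t1]; rewrite s0 in t0 t1.
    have t01 : 0 < t <= 1 by rewrite t0; lra.
    split; first by apply: contact_ray => //; rewrite ltW //; lra.
    by move=> _; apply: crease_ray rad vr cv t01.
  have [|es /(_ s0) cs] := hs s; first by rewrite lexx ltW.
  have [r1 r10 h1] := crease_line fold cs.
  have [d /andP[d0 ds] hd] := small_scale r10 (dsq_ge0 v 0) s0.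
  exists d => // t /andP[st td].
  have d2 : 0 < d / 2 by rewrite divr_gt0.
  have ds2 : 0 < s - d / 2 by lra.
  (* The second crease point, slightly behind, that [crease_line] needs to fix the direction. *)
  have [|e2 /(_ ds2) c2] := hs (s - d / 2); first by lra.
  have ne : q + (s - d / 2) *: v != q + s *: v.
    rewrite (inj_eq (addrI q)) -subr_eq0 -scalerBl scaler_eq0 negb_or v0 andbT.
    by apply/eqP; lra.
  have d2r : dsq (q + (s - d / 2) *: v) (q + s *: v) < r1.
    by rewrite dsq_along hd // ler_norml; lra.
  have tr : dsq (q + t *: v) (q + s *: v) < r1.
    by rewrite dsq_along hd // ler_norml; lra.
  have [|ct et] := h1 _ _ ne d2r tr c2.
    by rewrite /cross !coordE; ring.
  by split=> //; apply: et.
Qed.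

End Vertices.

(** * Vertices trapped in a triangle *)

Lemma finite_argmax (R : realType) (T : eqType) (A : set T) (h : T -> R) :
  finite_set A -> A !=set0 -> exists2 m, A m & forall x, A x -> h x <= h m.
Proof.
move=> /finite_seqP[s ->]; elim: s => [|x s IH] [y /= ys] //.
case: s IH {y ys} => [_|z s IH].
  by exists x => [|y]; rewrite /= inE // => /eqP ->.
have [|m ms hm] := IH; first by exists z; rewrite /= inE eqxx.
have [xm|mx] := leP (h x) (h m).
  exists m => [|y]; rewrite /= inE; first by rewrite ms orbT.
  by move=> /predU1P[->//|/hm].
exists x => [|y]; rewrite /= inE ?eqxx // => /predU1P[->//|/hm ym].
exact: le_trans ym (ltW mx).
Qed.

Section Trapped.
Variable R : realType.
Local Notation plane := 'rV[R]_2.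
Variables (phi : plane -> plane) (fold : local_flat_folding phi).
Implicit Types (a b c p q x y z u v w e : plane) (r s t : R) (f g : plane -> plane)
  (C S : set plane).

(** [S] only bounds where edges may end, so it can be enlarged: this is how at most three removed
    points become three corners. *)
Definition trapped C S : Prop :=
  [/\ C `<=` vertex_point phi, finite_set C,
      forall p q, C p -> segment_edge phi (open_segment p q) p q -> C q \/ S q
    & forall p d, C p -> d != 0 -> ~ open_ray p d `<=` crease_point phi].

Definition corners a b c : set plane := [set x | [\/ x = a, x = b | x = c]].

Lemma cornersC a b c : corners a b c = corners b c a.
Proof. by apply/seteqP; split=> x /= -[]; by [constructor 1|constructor 2|constructor 3]. Qed.

Lemma vertex_not_crease q : vertex_point phi q -> ~ crease_point phi q.
Proof. by case. Qed.

Lemma open_segment_ray q v t T : 0 < t < T -> open_segment q (q + T *: v) (q + t *: v).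
Proof.
move=> /andP[t0 tT]; have T0 := lt_trans t0 tT; exists (t / T).
  by rewrite /= divr_gt0 //= ltr_pdivrMr ?mul1r.
by apply: plane_eq; rewrite !coordE; field; rewrite gt_eqF.
Qed.

Lemma trapped_follow C S f q v r : trapped C S -> C q -> radial_at phi q r ->
  plane_isometry f -> phi q = f q -> dsq (q + v) q < r ->
  phi (q + v) = f (q + v) -> crease_point phi (q + v) ->
  exists T, let x := q + T *: v in
    [/\ 0 < T, segment_edge phi (open_segment q x) q x, phi x = f x & C x \/ S x].
Proof.
move=> [Cv _ Cedge Cray] Cq rad iso eq vr ev cv.
have v0 : v != 0.
  by apply: contraPneq (Cv _ Cq) => v0 /vertex_not_crease; rewrite -[q]addr0 -v0.
case: (follow_crease fold (Cv _ Cq) rad iso eq vr ev cv) => [/Cray|]; first by case.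
move=> [T [T0 vT eT cT]]; exists T => /=.
have sq : segment_edge phi (open_segment q (q + T *: v)) q (q + T *: v).
  split=> //; [exact: Cv| |].
    by apply/eqP; rewrite addv_neq scaler_eq0 negb_or gt_eqF.
  move=> _ [t /= /andP[t0 t1] <-].
  have -> : (1 - t) *: q + t *: (q + T *: v) = q + (t * T) *: v.
    by apply: plane_eq; rewrite !coordE; ring.
  by apply: cT; rewrite mulr_gt0 // gtr_pMl.
by split=> //; apply: Cedge sq.
Qed.

(** From the member of [C] with the largest [cross e], some crease goes strictly further; its end is
    outside [C], hence in [S]. *)
Lemma trapped_inside C S p e : trapped C S -> C p -> e != 0 ->
  exists2 s, S s & 0 < cross e (s - p).
Proof.
move=> tr Cp e0; have [Cv Cfin _ _] := tr.
have [m Cm hm] := finite_argmax (fun x => cross e (x - p)) Cfin (ex_intro _ p Cp).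
have [r rad] := radial_exists fold m.
have [f [v [iso em ev [vr fv cv]]]] := vertex_crease fold (Cv _ Cm) rad e0.
have [T [T0 _ _ hT]] := trapped_follow tr Cm rad iso em vr fv cv.
have lt : cross e (m - p) < cross e (m + T *: v - p).
  rewrite [ltRHS](_ : _ = cross e (m - p) + T * cross e v) ?ltrDl ?mulr_gt0 //.
  by rewrite /cross !coordE; ring.
case: hT => [/hm|Sx]; first by rewrite leNgt lt.
exists (m + T *: v) => //; apply: le_lt_trans lt.
by have := hm p Cp; rewrite subrr cross0r.
Qed.

(** For [e] along a common line, [cross e] is constant on the corners, yet [trapped_inside] for [e]
    and [- e] puts corners strictly on both sides of [p]. *)
Lemma trapped_noncollinear C a b c p : trapped C (corners a b c) -> C p ->
  cross (b - a) (c - a) != 0.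
Proof.
move=> tr Cp; apply/eqP => h.
have [e [e0 eb ec]] : exists e, [/\ e != 0, cross e (b - a) = 0 & cross e (c - a) = 0].
  have [ba|ba] := eqVneq (b - a) 0; last by exists (b - a); rewrite crossvv.
  have [ca|ca] := eqVneq (c - a) 0; last by exists (c - a); rewrite ba cross0r crossvv.
  exists (const_mx 1); rewrite ba ca !cross0r; split=> //.
  by apply/eqP => /rowP/(_ ord0); rewrite !mxE; apply/eqP; rewrite oner_eq0.
have same x : corners a b c x -> cross e (x - p) = cross e (a - p).
  move=> hs; have -> : x - p = (x - a) + (a - p) by rewrite addrA subrK.
  rewrite crossDr; case: hs => ->; rewrite ?subrr ?cross0r ?eb ?ec add0r //.
have [s /same hs s0] := trapped_inside tr Cp e0.
have [|s' /same hs' s0'] := trapped_inside (e := - e) tr Cp; first by rewrite oppr_eq0.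
by move: s0 s0'; rewrite crossNl hs hs' oppr_gt0 => h1 /(lt_trans h1); rewrite ltxx.
Qed.

(* The barycentric coordinate of x at c in the triangle a b c. *)
Definition bary a b c x : R := cross (b - a) (x - a) / cross (b - a) (c - a).

(** The direction is scaled so that [trapped_inside] yields a corner with smaller coordinate than
    [p], and at the corners the coordinate is 0 or 1. *)
Lemma trapped_bary C a b c p : trapped C (corners a b c) -> C p -> 0 < bary a b c p.
Proof.
move=> tr Cp; have D0 := trapped_noncollinear tr Cp.
have e0 : (cross (b - a) (c - a))^-1 *: (a - b) != 0.
  rewrite scaler_eq0 negb_or invr_eq0 D0 /= -opprB oppr_eq0.
  exact: cross_neq0l D0.
have [s Ss] := trapped_inside tr Cp e0.
rewrite (_ : cross _ _ = bary a b c p - bary a b c s); last first.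
  by rewrite /bary /cross !coordE; ring.
rewrite subr_gt0; apply: le_lt_trans.
case: Ss => ->; rewrite /bary ?subrr ?cross0r ?crossvv ?mul0r //.
by rewrite divff // ler01.
Qed.

End Trapped.

(** * One isometry matched at both ends of a side *)

Section TrappedTriangle.
Variable R : realType.
Local Notation plane := 'rV[R]_2.
Variables (phi : plane -> plane) (fold : local_flat_folding phi).
Implicit Types (a b c p q x y z u v w e : plane) (r s t : R) (f g : plane -> plane)
  (C S : set plane).

Lemma bary_rot a b c x :
  bary c a b x = cross (x - a) (c - a) / cross (b - a) (c - a).
Proof. by congr (_ / _); rewrite /cross !coordE; ring. Qed.

Lemma sheet_towards q x d r : radial_at phi q r -> q != x -> dsq x q < r ->
  exists f t, [/\ plane_isometry f, phi q = f q, phi x = f x &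
    0 < t /\ phi (x + t *: d) = f (x + t *: d)].
Proof.
move=> rad qx xr; have [g [iso gq gx]] := iso_extend qx (rad.2 _ xr).
have [r1 r10 h1] := two_sheets_near fold iso rad qx xr (esym gq) (esym gx).
have [t /andP[t0 _] ht] := small_scale r10 (dsq_ge0 d 0) ltr01.
have [] := h1 (x + t *: d); first by rewrite dsq_addl dsqZ ht // gtr0_norm.
  by move=> hw; exists g, t.
move=> hw; exists (g \o refl q x), t; split=> //=; rewrite ?reflp ?reflx //.
exact: iso_comp iso (refl_iso qx).
Qed.

(* Start on the crease from p to a whose direction is closest to b, with the sheet
   f on the side of b. If the contact set of f missed b, then its member of C
   seen from a closest to b would be joined to a by a crease closer to b. *)
Lemma trapped_side C a b c p : trapped phi C (corners a b c) -> C p ->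
  segment_edge phi (open_segment p a) p a ->
  exists f, [/\ plane_isometry f, phi a = f a & phi b = f b].
Proof.
move=> tr C0 pa; have [Cv Cfin _ _] := tr; have va : vertex_point phi a by case: pa.
pose D := cross (b - a) (c - a); have D0 : D != 0 := trapped_noncollinear fold tr C0.
(* Barycentric coordinates at [b] and [c]. For [x] in [C], the form [ell x] below is positive on the
   side of the line [ax] that contains [b]. *)
pose be x := cross (x - a) (c - a) / D; pose ga x := cross (b - a) (x - a) / D.
have ga0 x : C x -> 0 < ga x by move=> Cx; apply: trapped_bary fold _ _ _ _ _ tr Cx.
have be0 x : C x -> 0 < be x.
  by move=> Cx; rewrite /be -bary_rot; apply: (trapped_bary fold _ Cx); rewrite cornersC.
pose L x := D^-1 *: (a - x); pose ell x y := cross (L x) (y - a).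
have ellE x y : ell x y = be y * ga x - ga y * be x.
  by move: D0; rewrite /ell /L /be /ga /D /cross !coordE => D0; field.
have ellD x y t v : ell x (y + t *: v) = ell x y + t * cross (L x) v.
  by rewrite /ell /cross !coordE; ring.
have ellB x y z : cross (L x) (y - z) = ell x y - ell x z.
  by rewrite /ell /cross !coordE; ring.
have ella x : ell x a = 0 by rewrite /ell subrr cross0r.
have ellx x : ell x x = 0 by rewrite ellE mulrC subrr.
have ellb x : ell x b = ga x.
  have beb : be b = 1 by exact: divff D0.
  have gab : ga b = 0 by rewrite /ga crossvv mul0r.
  by rewrite ellE beb gab mul1r mul0r subr0.
have ellc x : ell x c = - be x.
  have bec : be c = 0 by rewrite /be crossvv mul0r.
  have gac : ga c = 1 by exact: divff D0.
  by rewrite ellE bec gac mul1r mul0r sub0r.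
have aff z q t : z = q + t *: (a - q) -> be z = (1 - t) * be q /\ ga z = (1 - t) * ga q.
  by move=> ->; rewrite /be /ga /cross !coordE; split; ring.
have aL x : a - x = D *: L x by rewrite /L scalerA divff // scale1r.
have ellyx x y : ell y x = - ell x y by rewrite !ellE; ring.
clearbody ell L be ga D.
(* Direction seen from [a]: the larger the slope, the closer to [b]. *)
pose slope x := be x / ga x.
have slope_lt x y : C x -> C y -> (slope x < slope y) = (0 < ell x y).
  move=> Cx Cy; rewrite ellE subr_gt0 /slope.
  by rewrite ltr_pdivrMr ?ga0 // mulrAC ltr_pdivlMr ?ga0 // [be x * _]mulrC.
pose near_a := [set x | C x /\ segment_edge phi (open_segment x a) x a].
have [|p1 [C1 e1] max1] := @finite_argmax _ _ near_a slope _ (ex_intro _ p (conj C0 pa)).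
  by apply: sub_finite_set Cfin => x [].
have [_ _ p1a _ cr1] := e1.
have [r1 rad1] := radial_exists fold p1; have [r10 _] := rad1.
have [k /andP[k0 k1] hk] := small_scale r10 (dsq_ge0 (a - p1) 0) (@ltr01 R).
have {}k1 : k / 2 < 1 by lra.
have {hk} hk : (k / 2) ^+ 2 * dsq (a - p1) 0 < r1.
  by apply: hk; rewrite ger0_norm ?divr_ge0 ?ltW //; lra.
have {k0} k0 : 0 < k / 2 by rewrite divr_gt0.
move: (k / 2) k0 k1 hk => {}k k0 k1 hk.
pose v := k *: (a - p1); pose x := p1 + v.
have xr : dsq x p1 < r1 by rewrite /x dsq_addl dsqZ.
have v0 : v != 0.
  by rewrite scaler_eq0 negb_or gt_eqF //= subr_eq0 eq_sym; apply/eqP.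
have px_neq : p1 != x by rewrite addv_neq.
have cx : crease_point phi x.
  apply: cr1; exists k; first by rewrite /= k0.
  by rewrite /x /v; apply: plane_eq; rewrite !coordE; ring.
have [f [d [iso ep ex [d0 ey]]]] := sheet_towards (b - a) rad1 px_neq xr.
set y := x + d *: (b - a) in ey.
have vL : v = (k * D) *: L p1 by rewrite /v aL scalerA.
have ell_x : ell p1 x = 0 by rewrite /x /v ellD ellx aL crossZr crossvv !mulr0 addr0.
have ell_y : 0 < ell p1 y.
  by rewrite /y ellD ell_x add0r ellB ella subr0 ellb mulr_gt0 ?ga0.
(* The crease through [x] ends at a vertex point; neither this end nor [a] can lie inside the open
   crease leading to the other, so they coincide. *)
have ea : phi a = f a.
  have [T [T0 [_ vX _ _ crX] eX _]] := trapped_follow fold tr C1 rad1 iso ep xr ex cx.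
  have pX : p1 + T *: v = p1 + (T * k) *: (a - p1) by rewrite /v scalerA.
  have aE : a = p1 + k^-1 *: v.
    by rewrite /v scalerA mulVf ?gt_eqF // scale1r addrC subrK.
  have [Tk|Tk|Tk] := ltgtP T k^-1.
  - case: (vertex_not_crease vX); apply: cr1; rewrite aE.
    by apply: open_segment_ray; rewrite T0.
  - case: (vertex_not_crease va); apply: crX; rewrite aE.
    by apply: open_segment_ray; rewrite invr_gt0 k0.
  - by rewrite aE -Tk.
exists f; split=> //; apply: contrapT => nb.
(* [y] and [c] are on opposite sides of the line [p1 a], so a contact at [c] would unfold the crease
   point [x]. *)
have nc : phi c <> f c.
  move=> ec; case: cx => + _; apply.
  apply: (contact_both_sides fold iso rad1 px_neq xr ep ex ey ec).
  rewrite /x [p1 + v]addrC addrK -/x vL !crossZl !ellB ellx !subr0 ellc mulrACA !mulrN oppr_lt0.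
  have kD2 : 0 < (k * D) * (k * D).
    by rewrite -expr2 exprn_even_gt0 //= mulf_neq0 // gt_eqF.
  by rewrite mulr_gt0 // mulr_gt0 // be0.
(* The crease found cannot end at a corner: [a] is on the line through [q], and [b] and [c] are not
   contacts. *)
have step q u w r : C q -> radial_at phi q r -> phi q = f q -> phi (q + u) = f (q + u) ->
    phi (q + w) = f (q + w) -> cross u w != 0 -> 0 < cross (L q) u ->
    exists z, [/\ C z, phi z = f z & 0 < ell q z].
  move=> Cq rad eq eu ew uw Lu.
  have [v' [Lv vr ev cv]] := crease_in_contact fold (Cv _ Cq) rad iso eq eu ew uw Lu.
  have [T [T0 _ eT hT]] := trapped_follow fold tr Cq rad iso eq vr ev cv.
  have lT : 0 < ell q (q + T *: v') by rewrite ellD ellx add0r mulr_gt0.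
  exists (q + T *: v'); split=> //; case: hT => // -[hz|hz|hz].
  - by move: lT; rewrite hz ella ltxx.
  - by move: eT; rewrite hz => /nb.
  - by move: eT; rewrite hz => /nc.
have addK z q : q + (z - q) = z by rewrite addrC subrK.
have [p2 [C2 e2 l2]] : exists z, [/\ C z, phi z = f z & 0 < ell p1 z].
  have Ly : 0 < cross (L p1) (y - p1) by rewrite ellB ellx subr0.
  apply: (step p1 (y - p1) v r1); rewrite ?addK //.
  by rewrite crossC vL crossZl oppr_eq0 mulf_neq0 ?mulf_neq0 ?(gt_eqF k0) ?(gt_eqF Ly).
pose Q := [set z | C z /\ phi z = f z].
have Qfin : finite_set Q by apply: sub_finite_set Cfin => z [].
have [m [Cm em] hm] := finite_argmax slope Qfin (ex_intro _ p2 (conj C2 e2)).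
(* Points of equal slope share a ray from [a]; the least [be] selects the one nearest to [a]. *)
pose Q' := [set z | Q z /\ slope z = slope m].
have [||q [[Cq eq] sq] hq] := @finite_argmax _ _ Q' (fun z => - be z).
- by apply: sub_finite_set Qfin => z [].
- by exists m.
have maxq z : C z -> phi z = f z -> ell q z <= 0.
  by move=> Cz ez; rewrite leNgt -slope_lt // -leNgt sq; apply: hm.
have l1q : 0 < ell p1 q.
  by rewrite -slope_lt // sq; apply: lt_le_trans (hm p2 _) => //; rewrite slope_lt.
have lq1 : ell q p1 < 0.
  by rewrite ellyx oppr_lt0.
have qa : a != q.
  by apply: contraTneq l1q => <-; rewrite ella ltxx.
have below z : phi z = f z -> ell q z <= 0.
  move=> ez; rewrite leNgt; apply/negP => lz.
  have [r rad] := radial_exists fold q.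
  have lz' : 0 < cross (L q) (z - q) by rewrite ellB ellx subr0.
  have [z' [Cz' ez' lz'']] : exists z, [/\ C z, phi z = f z & 0 < ell q z].
    apply: (step q (z - q) (a - q) r); rewrite ?addK //.
    by rewrite crossC aL crossZl oppr_eq0 mulf_neq0 ?(gt_eqF lz').
  by have := maxq z' Cz' ez'; rewrite leNgt lz''.
have [r rad] := radial_exists fold q; have [r0 _] := rad.
have [j /andP[j0 j1] hj] := small_scale r0 (dsq_ge0 (a - q) 0) (@ltr01 R).
pose w := j *: (a - q).
have w0 : w != 0 by rewrite scaler_eq0 negb_or gt_eqF //= subr_eq0.
have qw : q != q + w by rewrite addv_neq.
have wr : dsq (q + w) q < r by rewrite dsq_addl dsqZ hj // gtr0_norm.
have ew : phi (q + w) = f (q + w).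
  by apply: contact_segment => //; rewrite ltW.
have lw : ell q (q + w) = 0 by rewrite /w ellD ellx aL crossZr crossvv !mulr0 addr0.
(* If the point just after [q] towards [a] is unfolded, contact spreads to the [b] side, against
   [below]. If it is a crease, the end of the crease contradicts the choice of [q] (in [C]), of [p1]
   (at [a]), or [nb] and [nc]. *)
case: (punctured_unfolded_or_crease fold rad qw wr) => [unf|cw].
  have [|r' r'0 hr'] := unfolded_flat fold iso unf ew eq ep.
    rewrite (_ : q - (q + w) = - (j * D) *: L q); last first.
      by rewrite opprD addNKr /w aL scalerA scaleNr.
    by rewrite crossZl ellB lw subr0 mulf_neq0 ?oppr_eq0 ?mulf_neq0 ?(gt_eqF j0) ?(lt_eqF lq1).
  have [t /andP[t0 _] ht] := small_scale r'0 (dsq_ge0 (b - a) 0) (@ltr01 R).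
  have := below (q + w + t *: (b - a)).
  rewrite hr' ?dsq_addl ?dsqZ ?ht ?gtr0_norm // => /(_ erefl).
  by rewrite ellD lw add0r ellB ella subr0 ellb leNgt mulr_gt0 ?ga0.
have [T [T0 sX eX hX]] := trapped_follow fold tr Cq rad iso eq wr ew cw.
have [bX gX] : be (q + T *: w) = (1 - T * j) * be q /\ ga (q + T *: w) = (1 - T * j) * ga q.
  by apply: aff; rewrite /w scalerA.
case: hX => [CX|[hX|hX|hX]].
- have Tj : 0 < 1 - T * j by have := be0 _ CX; rewrite bX pmulr_lgt0 // be0.
  have : - be (q + T *: w) <= - be q.
    apply: hq; split; first by split.
    rewrite -sq /slope bX gX; field.
    by rewrite (gt_eqF (ga0 _ Cq)) (gt_eqF Tj).
  rewrite lerN2 bX leNgt => /negP; apply; rewrite gtr_pMl ?be0 //.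
  by rewrite ltrBlDr ltrDl mulr_gt0.
- have : slope q <= slope p1 by apply: max1; split=> //; move: sX; rewrite hX.
  by rewrite leNgt slope_lt // l1q.
- by move: eX; rewrite hX => /nb.
- by move: eX; rewrite hX => /nc.
Qed.

End TrappedTriangle.

(** * Rigidity of the triangle *)

Section TrappedEmpty.
Variable R : realType.
Local Notation plane := 'rV[R]_2.
Variables (phi : plane -> plane) (fold : local_flat_folding phi).
Implicit Types (a b c p q x y z : plane) (r s t : R) (f g : plane -> plane) (C S : set plane).

(** Otherwise [a] could be dropped, and [C] would be trapped by the degenerate triangle [b c c]. *)
Lemma trapped_adjacent C a b c p : trapped phi C (corners a b c) -> C p ->
  exists2 q, C q & segment_edge phi (open_segment q a) q a.
Proof.
move=> tr Cp; apply: contrapT => none; have [Cv Cfin Cedge Cray] := tr.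
have tr' : trapped phi C (corners b c c).
  split=> // x y Cx xy; have [?|[ya|yb|yc]] := Cedge x y Cx xy.
  - by left.
  - by case: none; exists x => //; rewrite -ya.
  - by right; constructor 1.
  - by right; constructor 2.
by have := trapped_noncollinear fold tr' Cp; rewrite crossvv eqxx.
Qed.

Lemma trapped_isometric C a b c p : trapped phi C (corners a b c) -> C p ->
  dsq (phi a) (phi b) = dsq a b.
Proof.
move=> tr Cp; have [q Cq qa] := trapped_adjacent tr Cp.
by have [f [iso -> ->]] := trapped_side fold tr Cq qa; apply: iso_dsq.
Qed.

Lemma bary_sum a b c x : cross (b - a) (c - a) != 0 ->
  bary b c a x + bary c a b x + bary a b c x = 1.
Proof.
rewrite (bary_rot a b c) /bary => D0.
have -> : cross (c - b) (a - b) = cross (b - a) (c - a).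
  by rewrite /cross !coordE; ring.
by move: D0; rewrite /cross !coordE => D0; field.
Qed.

Lemma bary_expand a b c x : cross (b - a) (c - a) != 0 ->
  x = a + (bary c a b x *: (b - a) + bary a b c x *: (c - a)).
Proof.
move=> D0; rewrite (bary_rot a b c) /bary; move: D0; rewrite /cross.
by move=> D0; apply: plane_eq; rewrite !coordE; field; move: D0; rewrite !coordE.
Qed.

Lemma contact_triangle f a b c x : plane_isometry f ->
  phi a = f a -> phi b = f b -> phi c = f c -> cross (b - a) (c - a) != 0 ->
  0 < bary b c a x -> 0 < bary c a b x -> 0 < bary a b c x -> phi x = f x.
Proof.
move=> iso ea eb ec D0 al0 be0 ga0.
move: al0 be0 ga0 (bary_sum x D0) (bary_expand x D0).
move: (bary b c a x) (bary c a b x) (bary a b c x) => al be ga al0 be0 ga0 sum1 ->.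
(* The point where the line from [a] through the given point meets the side [bc]; convexity is then
   used twice. *)
pose m := b + (ga / (be + ga)) *: (c - b).
have bg0 : 0 < be + ga by rewrite addr_gt0.
have em : phi m = f m.
  apply: contact_segment => //; rewrite divr_ge0 ?(ltW ga0) ?(ltW bg0) //=.
  by rewrite ler_pdivrMr // mul1r lerDr (ltW be0).
rewrite (_ : _ + _ = a + (be + ga) *: (m - a)).
  apply: contact_segment => //; rewrite (ltW bg0) /= -sum1 -addrA lerDr.
  exact: ltW.
by apply: plane_eq; rewrite /m !coordE; field; rewrite gt_eqF.
Qed.

Lemma bary_near a b c p : 0 < bary a b c p ->
  exists2 r, 0 < r & forall x, dsq x p < r -> 0 < bary a b c x.
Proof.
move=> h.
have cont : {for p, continuous (bary a b c)}.
  rewrite (_ : bary a b c = (fun x => cross (b - a) (x - a)) \* cst (cross (b - a) (c - a))^-1) //.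
  by apply: continuousM; [exact: cross_continuous|exact: cst_continuous].
have N : nbhs (bary a b c p) [set t | 0 < t].
  by apply: open_nbhs_nbhs; split=> //; exact: open_gt.
by have [r r0 hr] := (nbhs_dsq _ _).1 (cont _ N); exists r.
Qed.

Lemma trapped_empty C a b c p : trapped phi C (corners a b c) -> ~ C p.
Proof.
move=> tr Cp; have D0 := trapped_noncollinear fold tr Cp.
have tr1 : trapped phi C (corners b c a) by rewrite -cornersC.
have tr2 : trapped phi C (corners c a b) by rewrite cornersC.
have ab : a != b.
  by apply: contraNneq D0 => ->; rewrite subrr /cross !coordE !mul0r subrr.
have [f [isof fa fb]] := iso_extend ab
  (etrans (etrans (dsqC _ _) (trapped_isometric tr Cp)) (dsqC _ _)).
(* The kept side lengths leave two places for [phi c]; if it is the mirrored one, composing with the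
   reflection in [ab] repairs [f]. *)
have [g [isog ga gb gc]] : exists g, [/\ plane_isometry g, phi a = g a, phi b = g b & phi c = g c].
  case: (@iso_two _ f a b c (phi c) isof ab).
  - by rewrite fa (trapped_isometric tr2 Cp).
  - by rewrite fb dsqC (trapped_isometric tr1 Cp) dsqC.
  - by exists f.
  exists (f \o refl a b); rewrite /= reflp reflx; split=> //.
  exact: iso_comp isof (refl_iso ab).
have [r1 r10 h1] := bary_near (trapped_bary fold tr Cp).
have [r2 r20 h2] := bary_near (trapped_bary fold tr1 Cp).
have [r3 r30 h3] := bary_near (trapped_bary fold tr2 Cp).
have [Cv _ _ _] := tr; have [nunf _ _] := Cv _ Cp; apply: nunf.
apply: (@flat_unfolded _ phi g p (Num.min r1 (Num.min r2 r3))) => //.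
  by rewrite !lt_min r10 r20.
move=> x; rewrite !lt_min => /and3P[/h1 ? /h2 ? /h3 ?].
exact: (contact_triangle isog ga gb gc D0).
Qed.

End TrappedEmpty.

(** * The folding graph *)

Section FoldingGraph.
Variable R : realType.
Local Notation plane := 'rV[R]_2.
Variable phi : plane -> plane.
Implicit Types (a b c d p q x y z : plane) (r s t : R) (e S : set plane)
  (u v w : option plane).

(** Euclidean closure, used to recover the ends of an edge from its set of points. *)
Definition adherent e x : Prop := forall r, 0 < r -> exists2 y, e y & dsq y x < r.

Lemma adherent_cross e x p d k : adherent e x ->
  (forall y, e y -> cross d (y - p) <= k) -> cross d (x - p) <= k.
Proof.
move=> adh h; rewrite leNgt; apply/negP => hx.
have N : nbhs (cross d (x - p)) [set t | k < t].
  by apply: open_nbhs_nbhs; split=> //; exact: open_gt.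
have [r r0 hr] := (nbhs_dsq _ _).1 (@cross_continuous _ d p x _ N).
have [y /h yk /hr /=] := adh r r0.
by rewrite ltNge yk.
Qed.

(** A closed ray is an intersection of three closed half planes, and each of them passes from [e] to
    its adherent points. *)
Lemma adherent_ray e x p d : d != 0 -> adherent e x ->
  (forall y, e y -> exists2 t, 0 <= t & y = p + t *: d) ->
  exists2 t, 0 <= t & x = p + t *: d.
Proof.
move=> d0 adh h; have dd : 0 < dsq d 0 by rewrite dsq_gt0.
have c1 : cross d (x - p) <= 0.
  apply: adherent_cross adh _ => _ /h[t _ ->].
  by rewrite addrC addKr crossZr crossvv mulr0.
have c2 : cross (- d) (x - p) <= 0.
  apply: adherent_cross adh _ => _ /h[t _ ->].
  by rewrite addrC addKr crossNl crossZr crossvv mulr0 oppr0.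
have c3 : cross (perp d) (x - p) <= 0.
  apply: adherent_cross adh _ => _ /h[t t0 ->].
  by rewrite addrC addKr crossZr crossC cross_perp mulrN oppr_le0 mulr_ge0 ?(ltW dd).
have c0 : cross d (x - p) = 0.
  by apply/eqP; rewrite eq_le c1 -oppr_le0 -crossNl.
have dotE : dot d (x - p) = - cross (perp d) (x - p).
  by rewrite /dot /cross px_perp py_perp; ring.
exists (dot d (x - p) / dsq d 0).
  by rewrite divr_ge0 ?(ltW dd) // dotE oppr_ge0.
apply: (addrI (- p)); rewrite addKr addrC.
apply: (scalerI (lt0r_neq0 dd)); rewrite frame_expand c0 scale0r addr0 scalerA.
by rewrite mulrCA divff ?mulr1 // gt_eqF.
Qed.

Lemma open_segmentC p q : open_segment p q = open_segment q p.
Proof.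
suff sub x y : open_segment x y `<=` open_segment y x by apply/seteqP; split; apply: sub.
move=> _ [t /= /andP[t0 t1] <-]; exists (1 - t).
  by rewrite /= subr_gt0 t1 gtrBl.
by apply: plane_eq; rewrite !coordE; ring.
Qed.

Lemma open_segment_on_ray p q y :
  open_segment p q y -> exists2 t, 0 <= t & y = p + t *: (q - p).
Proof.
move=> [t /= /andP[t0 _] <-]; exists t; first exact: ltW.
by apply: plane_eq; rewrite !coordE; ring.
Qed.

Lemma adherent_start p d e : (forall t, 0 < t < 1 -> e (p + t *: d)) -> adherent e p.
Proof.
move=> h r r0; have [k /andP[k0 k1] hk] := small_scale r0 (dsq_ge0 d 0) (@ltr01 R).
exists (p + (k / 2) *: d); first by apply: h; lra.
by rewrite dsq_addl dsqZ hk // ger0_norm; lra.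
Qed.

Lemma adherent_segment p q : adherent (open_segment p q) p.
Proof.
apply: (@adherent_start _ (q - p)) => t t01; exists t => //.
by apply: plane_eq; rewrite !coordE; ring.
Qed.

Lemma joinsC e u v : folding_joins phi e u v -> folding_joins phi e v u.
Proof.
case: u v => [p|] [q|] //= [vp vq pq eE ecr].
by split=> //; [exact: nesym|rewrite open_segmentC].
Qed.

Lemma joins_adherent e p v : folding_joins phi e (Some p) v ->
  vertex_point phi p /\ adherent e p.
Proof.
case: v => [q|] /=; first by move=> [vp _ _ -> _]; split=> //; exact: adherent_segment.
move=> [vp [d [d0 -> _]]]; split=> //; apply: (@adherent_start _ d) => t /andP[t0 _].
by exists t.
Qed.

(** The point lies in the closed ray or segment, the latter being the intersection of the rays from
    its two ends; inside there are only creases. *)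
Lemma adherent_joins e u v x : folding_joins phi e u v -> vertex_point phi x ->
  adherent e x -> Some x = u \/ Some x = v.
Proof.
have ray y p : ray_edge phi e p -> vertex_point phi y -> adherent e y -> y = p.
  move=> [_ [d [d0 eE ecr]]] vy adh.
  have [z|t] := adherent_ray d0 adh (p := p).
    by rewrite eE => -[t /= t0 <-]; exists t => //; exact: ltW.
  rewrite le0r => /predU1P[-> ->|t0 yE]; first by rewrite scale0r addr0.
  by case: (vertex_not_crease vy); apply: ecr; rewrite eE yE; exists t.
case: u v => [p|] [q|] //=; last 2 first.
- by move=> h vx ax; left; rewrite (ray _ _ h vx ax).
- by move=> h vx ax; right; rewrite (ray _ _ h vx ax).
move=> [vp vq pq eE ecr] vx adh.
have [||t t0 xt] := @adherent_ray e x p (q - p) _ adh.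
- by rewrite subr_eq0 eq_sym; apply/eqP.
- by move=> y; rewrite eE; exact: open_segment_on_ray.
have [||s s0 xs] := @adherent_ray e x q (p - q) _ adh.
- by rewrite subr_eq0; apply/eqP.
- by move=> y; rewrite eE open_segmentC; exact: open_segment_on_ray.
have st : t = 1 - s.
  have : (t + s - 1) *: (q - p) = 0.
    have -> : (t + s - 1) *: (q - p) = (p + t *: (q - p)) - (q + s *: (p - q)).
      by apply: plane_eq; rewrite !coordE; ring.
    by rewrite -xt -xs subrr.
  move/eqP; rewrite scaler_eq0 => /orP[/eqP ?|]; first by lra.
  by rewrite subr_eq0 => /eqP h; case: pq.
have [t00|t00] := eqVneq t 0; first by left; rewrite xt t00 scale0r addr0.
have [s00|s00] := eqVneq s 0; first by right; rewrite xs s00 scale0r addr0.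
case: (vertex_not_crease vx); apply: ecr; rewrite eE; exists t.
  by rewrite /= lt_def t00 t0 st gtrBl lt_def s00.
by rewrite xt; apply: plane_eq; rewrite !coordE; ring.
Qed.

End FoldingGraph.

(** * Paths in a multigraph *)

Section Reachability.
Variables (V E : Type) (G : multigraph V E).
Hypothesis joins_sym : forall e u v, joins G e u v -> joins G e v u.

Lemma connected_refl u : connected_by_path G u u.
Proof. by exists [::]. Qed.

Lemma connected_step u v w :
  connected_by_path G u v -> adjacent_vertices G v w -> connected_by_path G u w.
Proof.
move=> [p pp pl] vw; exists (rcons p w); last by rewrite last_rcons.
by rewrite rcons_path pp pl; apply/asboolP.
Qed.

Lemma connected_trans u v w :
  connected_by_path G u v -> connected_by_path G v w -> connected_by_path G u w.
Proof.
move=> [p pp pl] [q qp ql]; exists (p ++ q); last by rewrite last_cat pl.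
by rewrite cat_path pp pl.
Qed.

Lemma connected_sym u v : connected_by_path G u v -> connected_by_path G v u.
Proof.
move=> [p + <-]; elim: p u => [|x p IH] u /=; first by move=> _; exact: connected_refl.
move=> /andP[/asboolP[e eG eux] /IH xl]; apply: connected_step xl _.
by exists e => //; apply: joins_sym.
Qed.

End Reachability.

Lemma card_le3_corners (R : realType) (S : set 'rV[R]_2) :
  (S #<= `I_3)%card -> exists a b c, S `<=` corners a b c.
Proof.
move=> /pcard_leP[f].
(* An index that is not taken yields the default point 0, a harmless extra corner since only an
   inclusion is claimed. *)
pose pick i := xget 0 [set x | S x /\ f x = i].
have pickE x : S x -> x = pick (f x).
  move=> Sx; rewrite /pick; case: xgetP => [y _ [Sy fy]|/(_ x)[]//].
  by apply: (@inj _ _ _ f); rewrite ?inE.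
exists (pick 0%N), (pick 1%N), (pick 2%N) => x Sx; rewrite (pickE x Sx).
have : (f x < 3)%N := @funS _ _ _ _ f x Sx.
by case: (f x) => [|[|[|//]]] _; [constructor 1|constructor 2|constructor 3].
Qed.

Theorem lemma3 (R : realType) (phi : 'rV[R]_2 -> 'rV[R]_2) (S : set 'rV[R]_2) :
  local_flat_folding phi ->
  finite_multigraph (folding_graph phi) ->
  S `<=` vertex_point phi ->
  (S #<= `I_3)%card ->
  ~ disconnected (remove_vertices (folding_graph phi) (Some @` S)).
Proof.
move=> fold [Vfin _] _ /card_le3_corners[a [b [c Sabc]]] [u [v [Gu Gv nuv]]].
pose G := remove_vertices (folding_graph phi) (Some @` S).
have Gsym e x y : joins G e x y -> joins G e y x by exact: joinsC.
(* Paths to [None] make sense even if it is not a vertex, and two vertices both connected to it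
   would be connected to each other. *)
have [w Gw nw] : exists2 w, vertices G w & ~ connected_by_path G w None.
  have [uN|] := pselect (connected_by_path G u None); last by exists u.
  have [vN|] := pselect (connected_by_path G v None); last by exists v.
  by case: nuv; apply: connected_trans uN (connected_sym Gsym vN).
case: w Gw nw => [p0|] Gw nw; last by case: nw; exact: connected_refl.
(* An edge survives only if no pair that it joins meets [S]; adherence shows that [x] and [y] are
   its only ends among the vertex points. *)
have keep e x y : folding_joins phi e x y -> ~ (Some @` S) x -> ~ (Some @` S) y ->
    adjacent_vertices G x y.
  move=> exy nx ny; exists e => //; split; first by exists x, y.
  have ends z z' : folding_joins phi e z z' -> ~ (Some @` S) z.
    move=> ezz [q Sq qz]; move: ezz; rewrite -qz => /joins_adherent[vq aq].
    have Sq' : (Some @` S) (Some q) by exists q.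
    by case: (adherent_joins exy vq aq) => qE; [apply: nx|apply: ny]; rewrite -qE.
  by move=> z z' ezz; split; [apply: ends ezz|apply: ends (joinsC ezz)].
pose C := [set p | [/\ vertex_point phi p, ~ S p & connected_by_path G (Some p0) (Some p)]].
have nS p : ~ S p -> ~ (Some @` S) (Some p) by move=> nSp [q Sq [qp]]; apply: nSp; rewrite -qp.
have nN : ~ (Some @` S) None by case.
suff tr : trapped phi C (corners a b c).
  apply: (trapped_empty fold tr (p := p0)).
  case: Gw => vp0 nSp0; split=> //; last exact: connected_refl.
split.
- by move=> p [].
- have : finite_set (Some @^-1` vertices (folding_graph phi)).
    by apply: finite_preimage Vfin => x y _ _ [].
  by apply: sub_finite_set => p [].
- move=> p q [vp nSp cp] pq; have [Sq|nSq] := pselect (S q); first by right; exact: Sabc.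
  left; split=> //; first by case: pq.
  by apply: connected_step cp (keep (open_segment p q) _ _ _ _ _) => //; exact: nS.
- move=> p d [vp nSp cp] d0 ray; apply: nw.
  apply: connected_step cp (keep (open_ray p d) _ _ _ _ _) => //; last exact: nS.
  by split=> //; exists d.
Qed.
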